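(* Let $A$ be a non-selfinjective Nakayama algebra with $n$ simple modules (up to isomorphism). Then $$\operatorname{sdomdim}(A) \leq 2n-\operatorname{Def}(A).$$
   Context: All algebras are finite dimensional quiver algebras $KQ/I$ ($K$ a field, $I$ an admissible ideal), connected and non-semisimple; all modules are finitely generated right modules. A Nakayama algebra with $n$ simple modules is such an algebra whose quiver $Q$ is either the line $0\to 1\to\dots\to n-1$ or the oriented cycle $0\to1\to\dots\to n-1\to 0$ (equivalently, every indecomposable left or right projective module is uniserial). The dominant dimension $\operatorname{domdim}(M)$ of a module $M$ with minimal injective coresolution $0\to M\to I_0\to I_1\to\cdots$ is $0$ if $I_0$ is not projective, and $\sup\{k \mid I_i \text{ is projective for } i=0,\dots,k\}+1$ if $I_0$ is projective. The defect $\operatorname{Def}(A)$ is the number of isomorphism classes of indecomposable injective non-projective $A$-modules. The super dominant dimension $\operatorname{sdomdim}(A)$ is the sum of the dominant dimensions of all (isomorphism classes of) indecomposable projective non-injective $A$-modules. *)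

(* Defs.v *)
From HB Require Import structures.
From mathcomp Require Import all_boot all_order all_algebra all_field.
From mathcomp Require Import finmap generic_quotient.
From mathcomp.multinomials Require Import monalg.
From mathcomp Require Import all_classical all_reals all_analysis.

Set Implicit Arguments.
Unset Strict Implicit.
Unset Printing Implicit Defensive.

Import Order.TTheory GRing.Theory Num.Theory.

Local Open Scope ring_scope.
Local Open Scope quotient_scope.

Record quiver := Quiver {
  vertex : finType;
  arrow : finType;
  src : arrow -> vertex;
  tgt : arrow -> vertex }.

Fixpoint walk (Q : quiver) (x : vertex Q) (s : seq (arrow Q)) : bool :=
  if s is a :: s' then (src a == x) && walk (tgt a) s' else true.

(* A path is its starting vertex together with its arrows in the order in which
   they are travelled; [(x, [::])] is the trivial path at [x]. *)
Definition qpath (Q : quiver) : choiceType :=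
  {p : vertex Q * seq (arrow Q) | walk p.1 p.2}.

Section Paths.
Variable Q : quiver.
Implicit Types p q r : qpath Q.

Definition pstart p : vertex Q := (val p).1.
Definition parrows p : seq (arrow Q) := (val p).2.
Definition pend p : vertex Q := last (pstart p) (map (@tgt Q) (parrows p)).
Definition plength p : nat := size (parrows p).

Definition ptriv (x : vertex Q) : qpath Q := exist _ (x, [::]) isT.

(* "first p, then q"; [insub] never fails here. *)
Definition pcat p q : option (qpath Q) :=
  if pend p == pstart q then insub (pstart p, parrows p ++ parrows q)
  else None.

Lemma walk_cat x s t :
  walk x (s ++ t) = walk x s && walk (last x (map (@tgt Q) s)) t.
Proof. by elim: s x => //= a s IH x; rewrite IH andbA. Qed.

Lemma pcat_val p q : pend p = pstart q ->
  exists2 r, pcat p q = Some r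
    & val r = (pstart p, parrows p ++ parrows q).
Proof.
move=> pq; rewrite /pcat pq eqxx; case: insubP => [r _ rE|]; first by exists r.
case/negP; rewrite /= walk_cat -/(pend p) pq.
by rewrite (valP p) (valP q).
Qed.

Lemma pcat_end p q r : pcat p q = Some r ->
  [/\ pend p = pstart q, val r = (pstart p, parrows p ++ parrows q),
      pstart r = pstart p & pend r = pend q].
Proof.
rewrite /pcat; case: eqP => // pq; case: insubP => // u _ uE [<-].
have su : pstart u = pstart p by rewrite /pstart uE.
split=> //; rewrite /pend su /parrows uE /= map_cat last_cat.
by rewrite -/(parrows p) -/(pend p) pq.
Qed.

Lemma pcatA p q r :
  obind (fun u => pcat u r) (pcat p q) = obind (pcat p) (pcat q r).
Proof.
have N u v : pend u != pstart v -> pcat u v = None.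
  by rewrite /pcat => /negPf->.
case: (eqVneq (pend p) (pstart q)) => [pq|pq]; last first.
  rewrite (N _ _ pq) /=; case E: (pcat q r) => [u|] //=.
  by have [_ _ uq _] := pcat_end E; rewrite N // uq.
have [u uE uv] := pcat_val pq; rewrite uE /=.
have [_ _ up uq] := pcat_end uE.
case: (eqVneq (pend q) (pstart r)) => [qr|qr]; last first.
  by rewrite (N _ _ qr) /= N // uq.
have [w wE wv] := pcat_val qr; rewrite wE /=.
have [_ _ wq wr] := pcat_end wE.
have [a -> av] := pcat_val (etrans uq qr).
have [b -> bv] := pcat_val (etrans pq (esym wq)).
congr Some; apply: val_inj.
by rewrite av bv up /parrows uv wv /= catA.
Qed.

Lemma pcat1p x p : pcat (ptriv x) p = if x == pstart p then Some p else None.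
Proof.
rewrite /pcat [pend _]/=; case: (eqVneq x (pstart p)) => // xp.
have -> : (pstart (ptriv x), parrows (ptriv x) ++ parrows p) = val p.
  by rewrite [pstart (ptriv x)]/= xp /pstart /parrows; case: (val p).
exact: valK.
Qed.

Lemma pcatp1 x p : pcat p (ptriv x) = if x == pend p then Some p else None.
Proof.
rewrite /pcat [pstart (ptriv x)]/= eq_sym; case: eqP => // _.
rewrite cats0 (_ : (pstart p, parrows p) = val p) ?valK //.
by rewrite /pstart /parrows; case: (val p).
Qed.

End Paths.

Lemma bilin_assoc (K : fieldType) (V : lmodType K) (T : Type) (b : T -> V)
    (op : V -> V -> V) :
  (forall P : V -> Prop, P 0 -> (forall f g, P f -> P g -> P (f + g)) ->
    (forall a f, P f -> P (a *: f)) -> (forall p, P (b p)) -> forall f, P f) ->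
  left_distributive op +%R -> right_distributive op +%R ->
  (forall a f g, op (a *: f) g = a *: op f g) ->
  (forall a f g, op f (a *: g) = a *: op f g) ->
  (forall p q r, op (b p) (op (b q) (b r)) = op (op (b p) (b q)) (b r)) ->
  associative op.
Proof.
move=> ind Dl Dr Zl Zr bA f g h.
have l0 u : op 0 u = 0 by have := Zl 0 0 u; rewrite !scale0r.
have r0 u : op u 0 = 0 by have := Zr 0 u 0; rewrite !scale0r.
elim/ind: f => [|f f' IH IH'|a f IH|p].
- by rewrite !l0.
- by rewrite !Dl IH IH'.
- by rewrite !Zl IH.
elim/ind: g => [|g g' IH IH'|a g IH|q].
- by rewrite !(l0, r0).
- by rewrite !(Dl, Dr) IH IH'.
- by rewrite !(Zl, Zr) IH.
elim/ind: h => [|h h' IH IH'|a h IH|r] //.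
- by rewrite !r0.
- by rewrite !Dr IH IH'.
- by rewrite !Zr IH.
Qed.

(* The path algebra KQ: the vector space on the paths of Q with the product
   given on paths by concatenation, or 0 if the paths are not composable. *)
Definition path_alg (K : fieldType) (Q : quiver) : Type :=
  malg (qpath Q) K.

HB.instance Definition _ (K : fieldType) (Q : quiver) :=
  GRing.Lmodule.on (path_alg K Q).

HB.lock Definition path_elt (K : fieldType) (Q : quiver) (p : qpath Q)
  : path_alg K Q := mkmalgU p 1.
Arguments path_elt K {Q} p.

Definition path_mul (K : fieldType) (Q : quiver) (p q : qpath Q)
  : path_alg K Q := if pcat p q is Some r then path_elt K r else 0.

HB.lock Definition palg_mul (K : fieldType) (Q : quiver) (f g : path_alg K Q)
  : path_alg K Q :=
  \sum_(p <- msupp f) \sum_(q <- msupp g)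
    (mcoeff p f * mcoeff q g) *: path_mul K p q.
Arguments palg_mul {K Q} f g.

Section PathAlgebra.
Variables (K : fieldType) (Q : quiver).
Implicit Types (p q r : qpath Q) (f g h : path_alg K Q).

Local Notation path_elt := (path_elt K).
Local Notation path_mul := (path_mul K).
Local Notation palg_mul := (@palg_mul K Q).

Definition palg_one : path_alg K Q := \sum_(x : vertex Q) path_elt (ptriv x).

Definition plin (W : lmodType K) (F : qpath Q -> W) f : W :=
  \sum_(p <- msupp f) mcoeff p f *: F p.

Lemma plinEw (W : lmodType K) (F : qpath Q -> W) (d : {fset qpath Q}) f :
  (msupp f `<=` d)%fset -> plin F f = \sum_(p <- d) mcoeff p f *: F p.
Proof.
by move=> fd; apply: big_fset_incl => // p _ /mcoeff_outdom ->; rewrite scale0r.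
Qed.

Lemma plinD (W : lmodType K) (F : qpath Q -> W) f g :
  plin F (f + g) = plin F f + plin F g.
Proof.
rewrite (plinEw _ (fsubsetUl (msupp f) (msupp g))).
rewrite (plinEw _ (fsubsetUr (msupp f) (msupp g))).
rewrite (plinEw _ (msuppD_le f g)) -big_split /=.
by apply: eq_bigr => p _; rewrite mcoeffD scalerDl.
Qed.

Lemma plinZ (W : lmodType K) (F : qpath Q -> W) a f :
  plin F (a *: f) = a *: plin F f.
Proof.
rewrite (plinEw _ (msuppZ_le a f)) scaler_sumr.
by apply: eq_bigr => p _; rewrite mcoeffZ scalerA.
Qed.

Lemma plin_elt (W : lmodType K) (F : qpath Q -> W) p : plin F (path_elt p) = F p.
Proof.
rewrite path_elt.unlock (plinEw _ msuppU_le) big_seq_fset1.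
by rewrite mcoeffUU scale1r.
Qed.

Lemma plin_is_linear (W : lmodType K) (F : qpath Q -> W) : linear (plin F).
Proof. by move=> a f g; rewrite plinD plinZ. Qed.

HB.instance Definition _ (W : lmodType K) (F : qpath Q -> W) :=
  GRing.isLinear.Build K (path_alg K Q) W _ (plin F) (plin_is_linear F).

Lemma path_coefZ a f p : mcoeff p (a *: f) = a * mcoeff p f.
Proof. exact: mcoeffZ. Qed.

Lemma path_coef_elt p q : mcoeff q (path_elt p) = (p == q)%:R.
Proof. by rewrite path_elt.unlock; exact: mcoeffU. Qed.

Lemma path_algE f : f = plin path_elt f.
Proof.
rewrite [LHS]monalgE /plin; apply: eq_bigr => p _.
apply/malgP => q; rewrite -[RHS]/(mcoeff q _) path_coefZ path_coef_elt.
by rewrite mcoeffU mulr_natr.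
Qed.

Lemma path_alg_ind (P : path_alg K Q -> Prop) :
  P 0 -> (forall f g, P f -> P g -> P (f + g)) ->
  (forall a f, P f -> P (a *: f)) -> (forall p, P (path_elt p)) ->
  forall f, P f.
Proof.
move=> P0 PD PZ PU f; rewrite (path_algE f).
by apply: (big_ind P) => // p _; apply: PZ.
Qed.

Lemma palg_mulE f g : palg_mul f g = plin (fun p => plin (path_mul p) g) f.
Proof.
rewrite palg_mul.unlock; apply: eq_bigr => p _; rewrite scaler_sumr.
by apply: eq_bigr => q _; rewrite scalerA.
Qed.

Lemma palg_mulDl : left_distributive palg_mul +%R.
Proof. by move=> f g h; rewrite !palg_mulE linearD. Qed.

Lemma palg_mulZl a f g : palg_mul (a *: f) g = a *: palg_mul f g.
Proof. by rewrite !palg_mulE linearZ. Qed.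

Lemma palg_mulDr : right_distributive palg_mul +%R.
Proof.
move=> f g h; rewrite !palg_mulE /plin -big_split /=.
by apply: eq_bigr => p _; rewrite -/(plin _ _) linearD scalerDr.
Qed.

Lemma palg_mulZr a f g : palg_mul f (a *: g) = a *: palg_mul f g.
Proof.
rewrite !palg_mulE {1 3}/plin scaler_sumr; apply: eq_bigr => p _.
by rewrite linearZ !scalerA mulrC.
Qed.

Lemma palg_mulUU p q : palg_mul (path_elt p) (path_elt q) = path_mul p q.
Proof. by rewrite palg_mulE !plin_elt. Qed.

Lemma palg_mul0l f : palg_mul 0 f = 0.
Proof. by rewrite palg_mulE linear0. Qed.

Lemma palg_mul0r f : palg_mul f 0 = 0.
Proof. by have := palg_mulZr 0 f 0; rewrite !scale0r. Qed.

Lemma palg_mulA : associative palg_mul.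
Proof.
apply: (bilin_assoc path_alg_ind palg_mulDl palg_mulDr palg_mulZl palg_mulZr).
move=> p q r.
rewrite (palg_mulUU q r) (palg_mulUU p q) /path_mul; have := pcatA p q r.
case: (pcat q r) => [u|]; case: (pcat p q) => [v|] /= E.
- by rewrite (palg_mulUU p u) (palg_mulUU v r) /path_mul E.
- by rewrite (palg_mulUU p u) palg_mul0l /path_mul -E.
- by rewrite (palg_mulUU v r) palg_mul0r /path_mul E.
- by rewrite palg_mul0l palg_mul0r.
Qed.

Lemma palg_mul1l : left_id palg_one palg_mul.
Proof.
elim/path_alg_ind => [|f f' IH IH'|a f IH|p].
- by rewrite !palg_mul0r.
- by rewrite !palg_mulDr IH IH'.
- by rewrite !palg_mulZr IH.
have -> : palg_mul palg_one (path_elt p) = \sum_x path_mul (ptriv x) p.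
  rewrite palg_mulE /palg_one linear_sum.
  by apply: eq_bigr => x _ /=; rewrite !plin_elt.
rewrite (bigD1 (pstart p)) //= big1 ?addr0; first by rewrite /path_mul pcat1p eqxx.
by move=> x /negPf xp; rewrite /path_mul pcat1p xp.
Qed.

Lemma palg_mul1r : right_id palg_one palg_mul.
Proof.
elim/path_alg_ind => [|f f' IH IH'|a f IH|p].
- by rewrite !palg_mul0l.
- by rewrite !palg_mulDl IH IH'.
- by rewrite !palg_mulZl IH.
have -> : palg_mul (path_elt p) palg_one = \sum_x path_mul p (ptriv x).
  rewrite palg_mulE plin_elt /palg_one linear_sum.
  by apply: eq_bigr => x _ /=; rewrite !plin_elt.
rewrite (bigD1 (pend p)) //= big1 ?addr0; first by rewrite /path_mul pcatp1 eqxx.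
by move=> x /negPf xp; rewrite /path_mul pcatp1 xp.
Qed.

HB.instance Definition _ := GRing.Zmodule_isPzRing.Build (path_alg K Q)
  palg_mulA palg_mul1l palg_mul1r palg_mulDl palg_mulDr.

Lemma palg_scaleAl a f g : a *: (f * g) = (a *: f) * g.
Proof. by rewrite -[RHS]/(palg_mul _ _) palg_mulZl. Qed.

Lemma palg_scaleAr a f g : a *: (f * g) = f * (a *: g).
Proof. by rewrite -[RHS]/(palg_mul _ _) palg_mulZr. Qed.

(* Membership in the m-th power of the arrow ideal, which is the span of the
   paths of length at least m. *)
Definition in_arrow_ideal_pow (m : nat) f : Prop :=
  forall p, p \in msupp f -> (m <= plength p)%N.

Definition admissible (I : path_alg K Q -> Prop) : Prop :=
  (forall f, I f -> in_arrow_ideal_pow 2 f) /\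
  exists2 m, (2 <= m)%N & forall f, in_arrow_ideal_pow m f -> I f.

End PathAlgebra.

(* A is isomorphic to KQ/I for some admissible I: the kernel of phi. *)
Definition quiver_algebra (K : fieldType) (Q : quiver) (A : falgType K) : Prop :=
  exists phi : {linear path_alg K Q -> A},
    [/\ monoid_morphism phi, (forall a : A, exists f, phi f = a)
       & admissible (fun f => phi f = 0)].

(* Up to isomorphism, a finitely generated right A-module is some space K^d of
   row vectors on which a \in A acts by v |-> v *m act a. *)
Record fgmod (K : fieldType) (A : falgType K) := FgMod {
  mdim : nat;
  act : {lrmorphism A -> 'M[K]_mdim} }.

Section Modules.
Variables (K : fieldType) (A : falgType K).
Implicit Types M N P I : fgmod A.

(* Morphisms act on row vectors from the right: "first f, then g" is
   [f *m g], and f is injective (surjective) iff [row_free f] ([row_full f]). *)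
Definition is_hom M N (f : 'M[K]_(mdim M, mdim N)) : Prop :=
  forall a : A, act M a *m f = f *m act N a.

Definition iso_mod M N : Prop :=
  exists f : 'M[K]_(mdim M, mdim N), [/\ is_hom f, row_free f & row_full f].

(* The row space of U is a submodule of M. *)
Definition submod M m (U : 'M[K]_(m, mdim M)) : Prop :=
  forall a : A, stablemx U (act M a).

Definition projective_mod P : Prop :=
  forall M N (g : 'M[K]_(mdim M, mdim N)) (f : 'M[K]_(mdim P, mdim N)),
    is_hom g -> row_full g -> is_hom f ->
    exists2 h : 'M[K]_(mdim P, mdim M), is_hom h & h *m g = f.

Definition injective_mod I : Prop :=
  forall M N (g : 'M[K]_(mdim M, mdim N)) (f : 'M[K]_(mdim M, mdim I)),
    is_hom g -> row_free g -> is_hom f ->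
    exists2 h : 'M[K]_(mdim N, mdim I), is_hom h & g *m h = f.

Definition indecomposable_mod M : Prop :=
  (0 < mdim M)%N /\
  forall U V : 'M[K]_(mdim M), submod U -> submod V ->
    (U :&: V = 0)%MS -> row_full (U + V)%MS -> U = 0 \/ V = 0.

Definition semisimple_mod M : Prop :=
  forall U : 'M[K]_(mdim M), submod U ->
    exists V : 'M[K]_(mdim M),
      [/\ submod V, (U :&: V = 0)%MS & row_full (U + V)%MS].

(* The right module A_A, in coordinates relative to [vbasis fullv]. *)
Definition regular_act (a : A) : 'M[K]_(\dim {:A}) :=
  passmx.mxof (vbasis {:A}) (vbasis {:A}) (amulr a).

Lemma regular_act_is_linear : linear regular_act.
Proof. by move=> k a b; rewrite /regular_act linearP passmx.mxof_linear. Qed.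

Lemma regular_act_is_monoid_morphism : monoid_morphism regular_act.
Proof.
have bA := vbasisP {:A}; rewrite /regular_act; split=> [|a b].
  rewrite (_ : amulr 1 = \1%VF) ?passmx.mxof1 ?(basis_free bA) //.
  by apply/lfunP => x; rewrite !lfunE /= mulr1.
rewrite (_ : amulr (a * b) = (amulr b \o amulr a)%VF).
  by rewrite (passmx.mxof_comp _ _ bA).
by apply/lfunP => x; rewrite !lfunE /= !lfunE /= mulrA.
Qed.

HB.instance Definition _ := GRing.isLinear.Build K A
  'M[K]_(\dim {:A}) _ regular_act regular_act_is_linear.
HB.instance Definition _ := GRing.isMonoidMorphism.Build A
  'M[K]_(\dim {:A}) regular_act regular_act_is_monoid_morphism.

Definition regular_mod : fgmod A := FgMod regular_act.

Definition selfinjective : Prop := injective_mod regular_mod.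

Definition semisimple_algebra : Prop := semisimple_mod regular_mod.

Definition essential M m (X : 'M[K]_(m, mdim M)) : Prop :=
  forall U : 'M[K]_(mdim M), submod U -> (U :&: X)%MS = 0 -> U = 0.

(* 0 -> M -> I_0 -> I_1 -> ... exact; minimality says that M is essential in
   I_0 and the image of I_i in I_{i+1} is essential, i.e. that I_{i+1} is an
   injective envelope of the cokernel of the preceding map. *)
Record min_inj_coresolution M := MinInjCoresolution {
  inj_term : nat -> fgmod A;
  coaug : 'M[K]_(mdim M, mdim (inj_term 0));
  codiff : forall i, 'M[K]_(mdim (inj_term i), mdim (inj_term i.+1));
  inj_termP : forall i, injective_mod (inj_term i);
  coaug_hom : is_hom coaug;
  codiff_hom : forall i, is_hom (codiff i);
  coaug_inj : row_free coaug;
  coaug_exact : (coaug :=: kermx (codiff 0))%MS;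
  codiff_exact : forall i, (codiff i :=: kermx (codiff i.+1))%MS;
  coaug_min : essential coaug;
  codiff_min : forall i, essential (codiff i) }.

(* \bar R only serves as a container for the natural numbers and +oo.  The
   minimal injective coresolution is unique up to isomorphism, so quantifying
   existentially over it does not depend on a choice. *)
Definition domdim (R : realType) M : \bar R :=
  if `[< exists C : min_inj_coresolution M, projective_mod (inj_term C 0) >]
  then (ereal_sup [set k%:R%:E | k in
          [set k : nat | exists C : min_inj_coresolution M,
            forall i, (i <= k)%N -> projective_mod (inj_term C i)]] + 1)%E
  else 0%E.

HB.instance Definition _ := gen_eqMixin (fgmod A).
HB.instance Definition _ := gen_choiceMixin (fgmod A).

Definition iso_rel : rel (fgmod A) := fun M N => `[< iso_mod M N >].

Lemma iso_refl : reflexive iso_rel.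
Proof.
move=> M; apply/asboolP; exists 1%:M; rewrite /row_free /row_full mxrank1 eqxx.
by split=> // a; rewrite mulmx1 mul1mx.
Qed.

Lemma iso_sym : symmetric iso_rel.
Proof.
suff sub M N : iso_mod M N -> iso_mod N M.
  by move=> M N; apply/idP/idP => /asboolP h; apply/asboolP; apply: sub.
move=> [f [hf rf cf]].
have [g fg] := row_freeP rf; have [g' gf'] := row_fullP cf.
have gg : g = g' by rewrite -[LHS]mul1mx -gf' -mulmxA fg mulmx1.
have gf : g *m f = 1%:M by rewrite gg.
exists g; split.
- move=> a; rewrite -[LHS]mul1mx -[1%:M]gf -!mulmxA (mulmxA f) -hf.
  by rewrite -!mulmxA fg mulmx1.
- by apply/row_freeP; exists f.
- by apply/row_fullP; exists f.
Qed.

Lemma iso_trans : transitive iso_rel.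
Proof.
move=> N M P /asboolP[f [hf rf cf]] /asboolP[g [hg rg cg]]; apply/asboolP.
exists (f *m g); split.
- by move=> a; rewrite mulmxA hf -!mulmxA hg.
- have [f' ff'] := row_freeP rf; have [g' gg'] := row_freeP rg.
  by apply/row_freeP; exists (g' *m f'); rewrite mulmxA -(mulmxA f) gg' mulmx1.
- have [f' ff'] := row_fullP cf; have [g' gg'] := row_fullP cg.
  by apply/row_fullP; exists (g' *m f'); rewrite mulmxA -(mulmxA g') ff' mulmx1.
Qed.

Definition iso_equiv : equiv_rel (fgmod A) :=
  EquivRel iso_rel iso_refl iso_sym iso_trans.

Definition isoclass := {eq_quot iso_equiv}.

(* All properties used below are invariant under isomorphism, hence may be
   tested on the chosen representative of a class. *)
Definition defect (R : realType) : \bar R :=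
  counting [set c : isoclass |
    [/\ indecomposable_mod (repr c), injective_mod (repr c)
       & ~ projective_mod (repr c)]].

Definition sdomdim (R : realType) : \bar R :=
  \esum_(c in [set c : isoclass |
    [/\ indecomposable_mod (repr c), projective_mod (repr c)
       & ~ injective_mod (repr c)]]) domdim R (repr c).

End Modules.

Arguments defect {K} A R.
Arguments sdomdim {K} A R.

(* 0 -> 1 -> ... -> n - 1 *)
Definition line_quiver (n : nat) : quiver :=
  @Quiver 'I_n {e : 'I_n * 'I_n | e.1.+1 == e.2 :> nat}
    (fun e => (val e).1) (fun e => (val e).2).

(* 0 -> 1 -> ... -> n - 1 -> 0; [ordS] is the successor modulo n. *)
Definition cycle_quiver (n : nat) : quiver :=
  @Quiver 'I_n 'I_n id (@ordS n).

Definition nakayama (K : fieldType) (A : falgType K) (n : nat) : Prop :=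
  ~ semisimple_algebra A /\
  (quiver_algebra (line_quiver n) A \/ quiver_algebra (cycle_quiver n) A).

(* Main.v *)
From HB Require Import structures.
Require Import Defs.
From mathcomp Require Import all_boot all_order all_algebra all_field.
From mathcomp Require Import generic_quotient.
From mathcomp.multinomials Require Import monalg.
From mathcomp Require Import all_classical all_reals all_analysis.

Set Implicit Arguments.
Unset Strict Implicit.
Unset Printing Implicit Defensive.

Import Order.TTheory GRing.Theory Num.Theory.

Local Open Scope ring_scope.

(* Uniserial modules are intervals ]z, y] of vertices, with top z + 1 and socle
   y.  Let ]g y, y] be the injective hull of the simple module at y, and call y
   good if it is projective.  In the minimal injective coresolution of an
   indecomposable projective ]z, y] the socles of the terms are y, z, g y, g z,
   g^2 y, g^2 z, ..., so that the dominant dimension is at most 2p + 1, where p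
   is the number of good vertices that the orbit of z under g meets before its
   first bad one.  Now g is injective on good vertices, and ]z, y] is injective
   if and only if z = g y' for a good y'.  Hence the good parts of the orbits
   of the starting points z are disjoint, there are as many starting points as
   bad vertices, and the defect is the number of bad vertices: for G good
   vertices the sum is at most 2G + (n - G) = 2n - (n - G). *)

(** * Modules and Fitting's lemma *)

Section ModuleTheory.
Variables (K : fieldType) (A : falgType K).
Implicit Types (M N P I J : fgmod A) (a b : A).

Lemma actM M a b : act M (a * b) = act M a *m act M b.
Proof. by rewrite rmorphM. Qed.

Lemma act1 M : act M 1 = 1%:M.
Proof. by rewrite rmorph1. Qed.

Lemma act_hom M a m (X : 'M[K]_(m, mdim M)) b :
  X *m act M (a * b) = X *m act M a *m act M b.
Proof. by rewrite actM mulmxA. Qed.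

Lemma is_hom1 M : is_hom (1%:M : 'M[K]_(mdim M)).
Proof. by move=> a; rewrite mulmx1 mul1mx. Qed.

Lemma is_homM M N P (f : 'M[K]_(mdim M, mdim N)) (g : 'M[K]_(mdim N, mdim P)) :
  is_hom f -> is_hom g -> is_hom (f *m g).
Proof. by move=> hf hg a; rewrite mulmxA hf -!mulmxA hg. Qed.

Lemma is_hom_inv M N (f : 'M[K]_(mdim M, mdim N)) (g : 'M[K]_(mdim N, mdim M)) :
  is_hom f -> f *m g = 1%:M -> g *m f = 1%:M -> is_hom g.
Proof.
move=> hf fg gf a.
by rewrite -[LHS]mul1mx -gf -!mulmxA (mulmxA f) -hf -!mulmxA fg mulmx1.
Qed.

Lemma submod_ker M N (f : 'M[K]_(mdim M, mdim N)) : is_hom f -> submod (kermx f).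
Proof.
move=> hf a; apply/sub_kermxP.
by rewrite -mulmxA hf mulmxA mulmx_ker mul0mx.
Qed.

Lemma submod_img M N (f : 'M[K]_(mdim M, mdim N)) : is_hom f -> submod f.
Proof. by move=> hf a; rewrite -hf submxMl. Qed.

Lemma is_homX M (f : 'M[K]_(mdim M)) k : is_hom f -> is_hom (iter k (mulmx f) 1%:M).
Proof.
move=> hf; elim: k => [|k IH] /=; first exact: is_hom1.
exact: is_homM.
Qed.

(** An iterate [F k0] of minimal rank has the same rank as all later ones. So the image and the
    kernel of the next iterate meet in 0 and span [M], and one of them vanishes. *)
Lemma fitting M (f : 'M[K]_(mdim M)) : indecomposable_mod M -> is_hom f ->
  (exists k, iter k (mulmx f) 1%:M = 0) \/ row_free f.
Proof.
move=> [_ indM] hf; pose F k := iter k (mulmx f) 1%:M.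
have FD j k : F (j + k)%N = F j *m F k.
  by elim: j => [|j IH]; rewrite ?mul1mx // addSn /F /= -/(F _) IH mulmxA.
have exr : exists r, `[< exists k, \rank (F k) = r >].
  by exists (\rank (F 0)); apply/asboolP; exists 0%N.
case: (ex_minnP exr) => r /asboolP[k0 rk0] rmin.
have rk j : \rank (F (j + k0)%N) = r.
  apply/eqP; rewrite eqn_leq rmin ?andbT; last by apply/asboolP; exists (j + k0)%N.
  by rewrite FD -rk0 mxrankM_maxr.
(* The shift to [k0.+1] puts the kernel of [f] inside that of [F k], even if [k0] is 0. *)
pose k := k0.+1; have rkk : \rank (F k) = r by rewrite /k -add1n rk.
have hF : is_hom (F k) by exact: is_homX.
have capF : (F k :&: kermx (F k) = 0)%MS.
  apply/eqP; rewrite -mxrank_eq0 -(eqn_add2l (\rank (F k *m F k))).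
  by rewrite mxrank_mul_ker addn0 -FD /k addnS -addSn rk rkk.
have full : row_full (F k + kermx (F k))%MS.
  rewrite /row_full; have := mxrank_sum_cap (F k) (kermx (F k)).
  rewrite capF mxrank0 addn0 => ->; rewrite mxrank_ker subnKC ?eqxx //.
  exact: rank_leq_col.
case: (indM _ _ (submod_img hF) (submod_ker hF) capF full) => [F0|ker0].
  by left; exists k.
right; rewrite -kermx_eq0 -submx0 -ker0; apply/sub_kermxP.
have -> : F k = f *m F k0 by [].
by rewrite mulmxA mulmx_ker mul0mx.
Qed.

(** A nonzero fixed vector excludes nilpotency. Columns play the role of linear forms, and
    [fitting_col] is the dual version. *)
Lemma fitting_row M (f : 'M[K]_(mdim M)) (v : 'rV_(mdim M)) :
  indecomposable_mod M -> is_hom f -> v != 0 -> v *m f = v -> row_free f.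
Proof.
move=> indM hf v0 vf; case: (fitting indM hf) => // -[k fk].
case/negP: v0; apply/eqP; rewrite -(mulmx0 _ v) -fk.
by elim: k {fk} => [|k IH] /=; rewrite ?mulmx1 // mulmxA vf.
Qed.

Lemma fitting_col M (f : 'M[K]_(mdim M)) (w : 'cV_(mdim M)) :
  indecomposable_mod M -> is_hom f -> w != 0 -> f *m w = w -> row_free f.
Proof.
move=> indM hf w0 fw; case: (fitting indM hf) => // -[k fk].
case/negP: w0; apply/eqP; rewrite -(mul0mx _ w) -fk.
by elim: k {fk} => [|k IH] /=; rewrite ?mul1mx // -mulmxA -IH.
Qed.

Lemma row_freeMl m p q (f : 'M[K]_(m, p)) (g : 'M[K]_(p, q)) :
  row_free (f *m g) -> row_free f.
Proof.
by move=> /row_freeP[h fgh]; apply/row_freeP; exists (g *m h); rewrite mulmxA.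
Qed.

Lemma iso_of_row_free M N (f : 'M[K]_(mdim M, mdim N)) (g : 'M[K]_(mdim N, mdim M)) :
  is_hom f -> row_free f -> row_free g -> iso_mod M N.
Proof.
move=> hf rf rg; exists f; split=> //.
rewrite /row_full eqn_leq rank_leq_col /= (eqP rf).
by rewrite -{1}(eqP rg) rank_leq_col.
Qed.

Lemma iso_inv M N : iso_mod M N ->
  exists f : 'M[K]_(mdim M, mdim N), exists g : 'M[K]_(mdim N, mdim M),
    [/\ is_hom f, is_hom g, f *m g = 1%:M & g *m f = 1%:M].
Proof.
move=> [f [hf rf cf]].
have [g fg] := row_freeP rf; have [g' gf'] := row_fullP cf.
have gg : g = g' by rewrite -[LHS]mul1mx -gf' -mulmxA fg mulmx1.
have gf : g *m f = 1%:M by rewrite gg.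
by exists f, g; split=> //; apply: is_hom_inv fg gf.
Qed.

End ModuleTheory.

(** * Presentations by vertices and arrows *)

(* An algebra KQ/I, for Q the line or the cycle: vtx x is the trivial path at x
   and arr the sum of all arrows.  For the line, ordS (n - 1) = 0 but
   vtx (n - 1) * arr = 0, so that both quivers satisfy the same relations. *)
Record cyclic_presentation (K : fieldType) (A : falgType K) (n : nat) := {
  vtx : 'I_n -> A;
  arr : A;
  vtxM : forall x y, vtx x * vtx y = if x == y then vtx x else 0;
  vtx_sum : \sum_x vtx x = 1;
  vtx_neq0 : forall x, vtx x != 0;
  vtx_arr : forall x, vtx x * arr = arr * vtx (ordS x);
  arr_nil : exists m, arr ^+ m = 0;
  alg_ind : forall P : A -> Prop, P 0 ->
    (forall a b, P a -> P b -> P (a + b)) ->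
    (forall (k : K) a, P a -> P (k *: a)) ->
    (forall x k, P (vtx x * arr ^+ k)) -> forall a, P a }.

Section Presentation.
Variables (K : fieldType) (A : falgType K) (n : nat).
Variable D : cyclic_presentation A n.
Implicit Types (M N P I J : fgmod A) (x y z : 'I_n).

Local Notation e := (vtx D).
Local Notation al := (arr D).
Local Notation S := (@ordS n).

Lemma alg_elim (P : A -> Prop) : P 0 ->
  (forall a b, P a -> P b -> P (a + b)) ->
  (forall (k : K) a, P a -> P (k *: a)) ->
  (forall x k, P (e x * al ^+ k)) -> forall a, P a.
Proof. exact: alg_ind. Qed.

Lemma vtxX x k : e x * al ^+ k = al ^+ k * e (iter k S x).
Proof.
elim: k => [|k IH]; first by rewrite expr0 mulr1 mul1r.
by rewrite !exprSr mulrA IH -!mulrA vtx_arr.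
Qed.

Lemma iterS_inj k : injective (iter k S).
Proof. by elim: k => //= k IH x y /(can_inj (@ordSK n))/IH. Qed.

(* m |-> \sum_k w(m al^k) v al^(l-1-k): every morphism from or to a uniserial
   module is of this form. *)
Definition hom_sum N M (w : 'cV[K]_(mdim N)) (v : 'rV[K]_(mdim M)) l :=
  \sum_(k < l) act N (al ^+ k) *m w *m (v *m act M (al ^+ (l - k.+1))).

Lemma hom_sum1 N M (w : 'cV[K]_(mdim N)) (v : 'rV[K]_(mdim M)) :
  hom_sum w v 1 = w *m v.
Proof. by rewrite /hom_sum big_ord1 subnn expr0 !act1 mul1mx mulmx1. Qed.

Lemma hom_gen N M (f : 'M[K]_(mdim N, mdim M)) :
  (forall x, act N (e x) *m f = f *m act M (e x)) ->
  act N al *m f = f *m act M al -> is_hom f.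
Proof.
move=> he hal.
elim/alg_elim => [|a b ha hb|k a ha|x k].
- by rewrite !rmorph0 mulmx0 mul0mx.
- by rewrite !rmorphD mulmxDl mulmxDr ha hb.
- have actZ M1 : act M1 (k *: a) = k *: act M1 a by exact: linearZ.
  by rewrite !actZ -scalemxAl -scalemxAr ha.
rewrite !actM -mulmxA.
suff -> : act N (al ^+ k) *m f = f *m act M (al ^+ k) by rewrite mulmxA he mulmxA.
elim: k => [|k IH]; first by rewrite expr0 !act1 mulmx1 mul1mx.
by rewrite exprS !actM -mulmxA IH mulmxA hal mulmxA.
Qed.

Lemma vtx_row M (v : 'rV[K]_(mdim M)) x k : v *m act M (e x) = v ->
  v *m act M (al ^+ k) *m act M (e (iter k S x)) = v *m act M (al ^+ k).
Proof. by move=> vx; rewrite -!act_hom -vtxX act_hom vx. Qed.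

Lemma vtx_row_neq M (v : 'rV[K]_(mdim M)) x y : v *m act M (e x) = v ->
  x != y -> v *m act M (e y) = 0.
Proof. by move=> <- /negPf xy; rewrite -act_hom vtxM xy rmorph0 mulmx0. Qed.

Lemma vtx_col N (w : 'cV[K]_(mdim N)) x k : act N (e (iter k S x)) *m w = w ->
  act N (e x) *m (act N (al ^+ k) *m w) = act N (al ^+ k) *m w.
Proof. by move=> wx; rewrite mulmxA -actM vtxX actM -mulmxA wx. Qed.

Lemma vtx_col_neq N (w : 'cV[K]_(mdim N)) x y : act N (e x) *m w = w ->
  x != y -> act N (e y) *m w = 0.
Proof.
by move=> <- /negPf xy; rewrite mulmxA -actM vtxM eq_sym xy rmorph0 mul0mx.
Qed.

(** Each summand passes through a single vertex, hence respects the idempotents. Acting by [al] on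
    either side shifts the summation index, and the two boundary terms vanish by the last two
    hypotheses. *)
Lemma hom_sum_hom N M (w : 'cV[K]_(mdim N)) (v : 'rV[K]_(mdim M)) z l :
  act N (e (iter l S z)) *m w = w -> v *m act M (e (S z)) = v ->
  act N (al ^+ l) *m w = 0 -> v *m act M (al ^+ l) = 0 ->
  is_hom (hom_sum w v l).
Proof.
move=> wy vz wl vl; apply: hom_gen => [x|]; rewrite mulmx_sumr mulmx_suml.
  apply: eq_bigr => k _; rewrite [LHS]mulmxA -[RHS]mulmxA.
  have El : iter l S z = iter k S (iter (l - k.+1) S (S z)).
    by rewrite -iterSr -iterD -subSn // subSS subnKC // ltnW.
  rewrite El in wy; have wk := vtx_col wy; have vk := vtx_row (l - k.+1) vz.
  have [<-|nx] := eqVneq (iter (l - k.+1) S (S z)) x; first by rewrite wk vk.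
  by rewrite (vtx_col_neq wk nx) (vtx_row_neq vk nx) mul0mx mulmx0.
pose F k := act N (al ^+ k) *m w *m (v *m act M (al ^+ (l - k))).
transitivity (\sum_(k < l) F k.+1).
  by apply: eq_bigr => k _; rewrite [LHS]mulmxA /F exprS actM !mulmxA.
transitivity (\sum_(k < l) F k); last first.
  apply: eq_bigr => k _; rewrite -[RHS]mulmxA /F -act_hom -exprSr.
  by rewrite -subSn // subSS.
apply: (addrI (F 0%N)); rewrite -(big_ord_recl _ F) big_ord_recr /=.
by rewrite [LHS]addrC /F subn0 vl wl mulmx0 mul0mx.
Qed.

Lemma pathl0 x : exists k, e x * al ^+ k == 0.
Proof. by have [m al0] := arr_nil D; exists m; rewrite al0 mulr0. Qed.

Lemma pathr0 y : exists k, al ^+ k * e y == 0.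
Proof. by have [m al0] := arr_nil D; exists m; rewrite al0 mul0r. Qed.

(* The lengths of the projective cover of the simple module at x and of the
   injective hull of the simple module at y. *)
Definition plen x := ex_minn (pathl0 x).
Definition ilen y := ex_minn (pathr0 y).

Lemma plenP x k : (e x * al ^+ k == 0) = (plen x <= k)%N.
Proof.
rewrite /plen; case: ex_minnP => m /eqP m0 mmin; apply/idP/idP => [/mmin//|mk].
by rewrite -(subnKC mk) exprD mulrA m0 mul0r.
Qed.

Lemma ilenP y k : (al ^+ k * e y == 0) = (ilen y <= k)%N.
Proof.
rewrite /ilen; case: ex_minnP => m /eqP m0 mmin; apply/idP/idP => [/mmin//|mk].
by rewrite -(subnK mk) exprD -mulrA m0 mulr0.
Qed.

Lemma plen_gt0 x : (0 < plen x)%N.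
Proof. by rewrite ltnNge -plenP expr0 mulr1 vtx_neq0. Qed.

Lemma ilen_gt0 y : (0 < ilen y)%N.
Proof. by rewrite ltnNge -ilenP expr0 mul1r vtx_neq0. Qed.

(** The Kupisch inequality for injectives: [al ^+ k.+1 * e (S y) = al ^+ k * e y * al]. *)
Lemma ilenS y : (ilen (S y) <= (ilen y).+1)%N.
Proof.
rewrite -ilenP exprSr -mulrA -vtx_arr mulrA.
by have := leqnn (ilen y); rewrite -ilenP => /eqP->; rewrite mul0r.
Qed.

(** The nonzero paths from [x] are linearly independent, so they have coordinate forms on [A]. *)
Lemma path_coord x : exists mu : 'I_(plen x) -> {linear A -> K^o},
  forall j k, mu j (e x * al ^+ k) = (k == j)%:R.
Proof.
pose X := [tuple e x * al ^+ (i : 'I_(plen x)) | i < plen x].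
have XE (i : 'I_(plen x)) : X`_i = e x * al ^+ i.
  by rewrite (nth_map i) ?size_enum_ord // nth_ord_enum.
have fX : free X.
  apply/freeP => k; under eq_bigr do rewrite XE; move=> k0.
  suff main m : forall i : 'I_(plen x), i = m :> nat -> k i = 0.
    by move=> i; apply: main.
  elim/ltn_ind: m => m IH i im.
  (* This power kills the terms beyond the [i]-th; the earlier coefficients vanish by induction. *)
  have : (\sum_j k j *: (e x * al ^+ j)) * al ^+ (plen x - i.+1) = 0.
    by rewrite k0 mul0r.
  rewrite mulr_suml (bigD1 i) //= big1 ?addr0 => [|j ji].
    rewrite -scalerAl -mulrA -exprD.
    have -> : (i + (plen x - i.+1) = (plen x).-1)%N.
      by rewrite -[in RHS](subnKC (ltn_ord i)) addSn.
    move=> /eqP; rewrite scaler_eq0 plenP -ltnS prednK ?plen_gt0 // ltnn orbF.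
    by move/eqP.
  have [jm|mj] := ltnP j m; first by rewrite (IH _ jm) // scale0r mul0r.
  have {}mj : (m < j)%N by rewrite ltn_neqAle mj andbT -im eq_sym.
  rewrite -scalerAl -mulrA -exprD; apply/eqP; rewrite scaler_eq0 plenP.
  by rewrite -{1}(subnKC (ltn_ord i)) im leq_add2r mj orbT.
exists (fun j => coord X j) => j k.
have [kx|xk] := ltnP k (plen x).
  by rewrite /= -[e x * _]/(e x * al ^+ Ordinal kx) -XE coord_free // -val_eqE eq_sym.
move: (xk); rewrite -plenP => /eqP->; rewrite linear0.
by rewrite gtn_eqF // (leq_trans (ltn_ord j)).
Qed.

(* M is uniserial with basis v al^k, k < l, and w is the coordinate along the
   socle v al^(l-1).  Its composition factors are S z, ..., S^l z, so M is
   thought of as the interval ]z, S^l z]. *)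
Definition uniserial M z l (v : 'rV[K]_(mdim M)) (w : 'cV[K]_(mdim M)) :=
  [/\ v *m act M (e (S z)) = v, act M (e (iter l S z)) *m w = w,
      v *m act M (al ^+ l) = 0, hom_sum w v l = 1%:M
    & forall k, v *m act M (al ^+ k) *m w = (k == l.-1)%:R%:M].

(** The module is the quotient of the projective [e (S z) A] by the paths of length at least [l], in
    the basis of the shorter paths. *)
Lemma uniserial_exists z l : (0 < l)%N -> (l <= plen (S z))%N ->
  exists M v w, @uniserial M z l v w.
Proof.
case: l => // l _ lz; have [mu muE] := path_coord (S z).
pose B (b : A) : 'M[K]_l.+1 :=
  \matrix_(i, j) mu (widen_ord lz j) (e (S z) * al ^+ i * b).
have BD a b : B (a + b) = B a + B b.
  by apply/matrixP => i j; rewrite !mxE mulrDr linearD.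
have BZ k a : B (k *: a) = k *: B a.
  by apply/matrixP => i j; rewrite !mxE -scalerAr linearZ.
have B0 : B 0 = 0 by have := BZ 0 0; rewrite !scale0r.
have BL : linear B by move=> k a b; rewrite BD BZ.
have BE x k i j :
    B (e x * al ^+ k) i j = ((x == iter i S (S z)) && (i + k == j)%N)%:R.
  rewrite mxE mulrA (vtxX (S z) i) -[_ * e _ * e x]mulrA vtxM.
  rewrite [iter _ _ _ == x]eq_sym; have [_|_] := eqVneq x (iter i S (S z)).
    by rewrite -vtxX -mulrA -exprD muE.
  by rewrite mulr0 mul0r linear0.
have BM : monoid_morphism B.
  split; first by apply/matrixP => i j; rewrite !mxE mulr1 muE.
  move=> a b; elim/alg_elim: a => [|a a' IH IH'|k a IH|x k].
  - by rewrite mul0r B0 mul0r.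
  - by rewrite mulrDl !BD IH IH' mulrDl.
  - by rewrite -scalerAl !BZ IH scalerAl.
  elim/alg_elim: b => [|b b' IH IH'|k' b IH|x' k'].
  - by rewrite mulr0 B0 mulr0.
  - by rewrite mulrDr !BD IH IH' mulrDr.
  - by rewrite -scalerAr !BZ IH scalerAr.
  apply/matrixP => i j.
  rewrite -[RHS]/((B (e x * al ^+ k) *m B (e x' * al ^+ k')) i j) [RHS]mxE.
  under eq_bigr do rewrite !BE.
  have -> : e x * al ^+ k * (e x' * al ^+ k') =
      if x' == iter k S x then e x * al ^+ (k + k') else 0.
    rewrite mulrA (vtxX x k) -[_ * e _ * e x']mulrA vtxM eq_sym.
    by case: eqP => _; rewrite ?mulr0 ?mul0r // -vtxX -mulrA -exprD.
  have [xE|nx] := eqVneq x (iter i S (S z)); last first.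
    rewrite big1 => [|s _]; last by rewrite andFb mul0r.
    by case: eqP => _; [rewrite BE (negPf nx) | rewrite B0 mxE].
  have [il|li] := ltnP (i + k) l.+1; last first.
    rewrite big1 => [|s _]; last first.
      by rewrite andTb gtn_eqF ?mul0r // (leq_trans (ltn_ord s)).
    case: eqP => _; last by rewrite B0 mxE.
    rewrite BE addnA gtn_eqF ?andbF //.
    by rewrite (leq_trans (ltn_ord j)) // (leq_trans li) ?leq_addr.
  rewrite (bigD1 (Ordinal il)) //= big1 ?addr0 => [|s]; last first.
    by rewrite -val_eqE /= eq_sym => /negPf->; rewrite mul0r.
  rewrite eqxx mul1r /= [iter (i + k) S _](_ : _ = iter k S x); last first.
    by rewrite addnC iterD xE.
  case: eqP => _; last by rewrite B0 mxE.
  by rewrite BE xE eqxx addnA.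
pose fB : {lrmorphism A -> 'M[K]_l.+1} := HB.pack B
  (GRing.isLinear.Build K A 'M[K]_l.+1 _ B BL)
  (GRing.isMonoidMorphism.Build A 'M[K]_l.+1 B BM).
have BT k i j : B (al ^+ k) i j = (i + k == j)%N%:R.
  by rewrite mxE -mulrA -exprD muE.
have BV x i j : B (e x) i j = ((x == iter i S (S z)) && (i == j)%N)%:R.
  by rewrite -[e x]mulr1 -(expr0 al) BE addn0.
pose M := @FgMod K A l.+1 fB; have MB b : act M b = B b by [].
exists M, (delta_mx 0 0), (delta_mx ord_max 0); split.
- by apply/rowP => j; rewrite MB -rowE [LHS]mxE BV mxE !eqxx eq_sym.
- apply/colP => i; rewrite MB -colE [LHS]mxE BV mxE andbT -val_eqE iterSr /= andbC.
  by case: eqP => //= ->; rewrite eqxx.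
- by apply/rowP => j; rewrite MB -rowE [LHS]mxE BT mxE gtn_eqF.
- apply/matrixP => i j; rewrite summxE.
  transitivity (\sum_(k < l.+1) ((i + k == l)%N%:R * (l - k == j)%N%:R : K)).
    apply: eq_bigr => k _; rewrite !MB -rowE -colE mxE big_ord1.
    by congr (_ * _); rewrite mxE BT.
  (* In row [i] only the summand [k = l - i] survives. *)
  rewrite (bigD1 (inord (l - i))) //= inordK ?ltnS ?leq_subr //.
  have il : (i <= l)%N by rewrite -ltnS.
  rewrite subnKC // eqxx mul1r subKn // mxE big1 ?addr0 // => k nk.
  case: eqP => [E|_]; last by rewrite mul0r.
  case/eqP: nk; apply: val_inj; rewrite /= inordK ?ltnS ?leq_subr //.
  by have /= <- := congr1 (subn^~ i) E; rewrite addKn.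
- move=> k; apply/matrixP => i j; rewrite MB -rowE -colE !ord1 [LHS]mxE [LHS]mxE.
  by rewrite BT !mxE eqxx mulr1n.
Qed.
End Presentation.

(** * Uniserial modules *)

Section Intervals.
Variables (K : fieldType) (A : falgType K) (n : nat).
Variable D : cyclic_presentation A n.
Implicit Types (M N P I J : fgmod A) (x y z : 'I_n).

Local Notation e := (vtx D).
Local Notation al := (arr D).
Local Notation S := (@ordS n).
Local Notation hom_sum := (@hom_sum _ _ _ D _ _).
Local Notation uniserial M := (@uniserial _ _ _ D M).
Local Notation plen := (plen D).
Local Notation ilen := (ilen D).

(** Since [al] is nilpotent, any nonzero vector of [U] has a last nonzero multiple by a power of
    [al]. *)
Lemma nil_socle M m (U : 'M[K]_(m, mdim M)) : U != 0 -> submod U ->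
  exists u : 'rV_(mdim M), [/\ u != 0, (u <= U)%MS & u *m act M al = 0].
Proof.
move=> U0 sU; have [m0 al0] := arr_nil D.
have /rowV0Pn[u uU u0] := U0.
have exk : exists k, u *m act M (al ^+ k) == 0.
  by exists m0; rewrite al0 rmorph0 mulmx0.
case: (ex_minnP exk) => -[|k] /eqP uk kmin.
  by rewrite expr0 act1 mulmx1 in uk; rewrite uk eqxx in u0.
exists (u *m act M (al ^+ k)); split.
- by apply/negP => /kmin; rewrite ltnn.
- exact: submx_trans (submxMr _ uU) (sU _).
- by rewrite -act_hom -exprSr.
Qed.

Lemma socle_vertex M m (U : 'M[K]_(m, mdim M)) : U != 0 -> submod U ->
  exists y (u : 'rV_(mdim M)),
    [/\ u != 0, (u <= U)%MS, u *m act M al = 0 & u *m act M (e y) = u].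
Proof.
move=> U0 sU; have [u [u0 uU ual]] := nil_socle U0 sU.
have [y uy] : exists y, u *m act M (e y) != 0.
  apply/existsP; rewrite -negb_forall; apply: contra u0 => /forallP uy0.
  rewrite -[u]mulmx1 -act1 -(vtx_sum D) raddf_sum mulmx_sumr big1 // => y _.
  exact/eqP/uy0.
exists y, (u *m act M (e y)); split=> //.
- exact: submx_trans (submxMr _ uU) (sU _).
- by rewrite -act_hom vtx_arr act_hom ual mul0mx.
- by rewrite -act_hom vtxM eqxx.
Qed.

(** Dual to [socle_vertex]: [w] is a linear form on the top of [M], concentrated at one vertex. *)
Lemma top_vertex M : (0 < mdim M)%N -> exists x (w : 'cV_(mdim M)),
  [/\ w != 0, act M al *m w = 0 & act M (e x) *m w = w].
Proof.
move=> M0; have [m0 al0] := arr_nil D.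
have exk : exists k, act M (al ^+ k) == 0 by exists m0; rewrite al0 rmorph0.
case: (ex_minnP exk) => -[|k] /eqP uk kmin.
  have : \rank (1%:M : 'M[K]_(mdim M)) = 0%N by rewrite -act1 -(expr0 al) uk mxrank0.
  by rewrite mxrank1 => M00; rewrite M00 in M0.
have nk : act M (al ^+ k) != 0 by apply/negP => /kmin; rewrite ltnn.
have [j wj] : exists j, col j (act M (al ^+ k)) != 0.
  apply/existsP; rewrite -negb_forall; apply: contra nk => /forallP cj.
  by apply/eqP/matrixP => i j; have /eqP/colP/(_ i) := cj j; rewrite !mxE.
have {wj} [w w0 wal] : exists2 w : 'cV_(mdim M), w != 0 & act M al *m w = 0.
  exists (col j (act M (al ^+ k))) => //.
  by rewrite colE mulmxA -actM -exprS uk mul0mx.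
have [x wx] : exists x, act M (e x) *m w != 0.
  apply/existsP; rewrite -negb_forall; apply: contra w0 => /forallP wx0.
  rewrite -[w]mul1mx -act1 -(vtx_sum D) raddf_sum mulmx_suml big1 // => y _.
  exact/eqP/wx0.
exists x, (act M (e x) *m w); split=> //.
- rewrite mulmxA -actM; have -> : al * e x = e (ord_pred x) * al.
    by rewrite vtx_arr ord_predK.
  by rewrite actM -mulmxA wal mulmx0.
- by rewrite mulmxA -actM vtxM eqxx.
Qed.

(** * Socle, submodules and morphisms of one uniserial module *)

Section IntervalModule.
Variables (M : fgmod A) (z : 'I_n) (l : nat).
Variables (v : 'rV[K]_(mdim M)) (w : 'cV[K]_(mdim M)).
Hypothesis Mi : uniserial M z l v w.

Lemma uniserial_gt0 : (0 < l)%N.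
Proof.
have [_ _ vl _ vk] := Mi; case: l vl vk => // vl /(_ 0%N).
rewrite vl mul0mx eqxx => /matrixP/(_ 0 0).
by rewrite !mxE eqxx => /esym/eqP; rewrite oner_eq0.
Qed.

Let v_top : v *m act M (al ^+ l.-1) *m w = 1%:M.
Proof. by have [_ _ _ _ ->] := Mi; rewrite eqxx. Qed.

Lemma uniserial_nil : act M (al ^+ l) = 0.
Proof.
have [_ _ vl M1 _] := Mi; rewrite -[LHS]mul1mx -M1 mulmx_suml big1 // => k _.
rewrite -!mulmxA -actM -exprD addnC exprD actM [v *m _]mulmxA vl.
by rewrite mul0mx !mulmx0.
Qed.

Lemma uniserial_gen N (u : 'rV[K]_(mdim N)) : v *m hom_sum w u l = u.
Proof.
have l0 := uniserial_gt0; have [_ _ _ _ vk] := Mi.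
have ltl : (l.-1 < l)%N by rewrite prednK.
rewrite mulmx_sumr (bigD1 (Ordinal ltl)) //= big1 ?addr0 => [|k nk].
  by rewrite !mulmxA v_top mul1mx prednK // subnn expr0 act1 mulmx1.
have {}nk : (k == l.-1 :> nat) = false := negPf nk.
by rewrite !mulmxA vk nk raddf0 !mul0mx.
Qed.

Lemma uniserial_expand m (f : 'M[K]_(m, mdim M)) :
  f = \sum_(k < l) f *m act M (al ^+ k) *m w *m (v *m act M (al ^+ (l - k.+1))).
Proof.
have [_ _ _ M1 _] := Mi; rewrite -[LHS]mulmx1 -M1 mulmx_sumr.
by apply: eq_bigr => k _; rewrite !mulmxA.
Qed.

(** Only the summand [k = 0] of the expansion survives, so the socle is the line spanned by
    [v al^(l-1)]. *)
Lemma uniserial_soc m (f : 'M[K]_(m, mdim M)) :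
  f *m act M al = 0 -> f = f *m w *m (v *m act M (al ^+ l.-1)).
Proof.
have l0 := uniserial_gt0; move=> f0; rewrite [LHS]uniserial_expand.
rewrite (bigD1 (Ordinal l0)) //= big1 ?addr0 => [|k nk].
  by rewrite expr0 act1 mulmx1 subn1.
have k0 : (0 < k)%N by rewrite lt0n.
by rewrite -(prednK k0) exprS act_hom f0 !mul0mx.
Qed.

Lemma uniserial_soc_step m (f : 'M[K]_(m, mdim M)) j :
  f *m act M (al ^+ j.+1) = 0 -> f *m act M (al ^+ j) *m w = 0 ->
  f *m act M (al ^+ j) = 0.
Proof.
move=> f0 fw; rewrite [LHS]uniserial_soc ?fw ?mul0mx //.
by rewrite -act_hom -exprSr.
Qed.

Lemma uniserial_soc_neq0 : v *m act M (al ^+ l.-1) != 0.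
Proof.
apply/eqP => v0; have := v_top; rewrite v0 mul0mx => /matrixP/(_ 0 0).
by rewrite !mxE eqxx => /esym/eqP; rewrite oner_eq0.
Qed.

Lemma uniserial_soc_al : v *m act M (al ^+ l.-1) *m act M al = 0.
Proof.
have [_ _ vl _ _] := Mi.
by rewrite -act_hom -exprSr prednK ?uniserial_gt0.
Qed.

Lemma uniserial_soc_vtx :
  v *m act M (al ^+ l.-1) *m act M (e (iter l S z)) = v *m act M (al ^+ l.-1).
Proof.
have [vz _ _ _ _] := Mi; have := vtx_row l.-1 vz.
by rewrite -iterSr prednK ?uniserial_gt0.
Qed.

Lemma uniserial_uniform m (U : 'M[K]_(m, mdim M)) :
  U != 0 -> submod U -> (v *m act M (al ^+ l.-1) <= U)%MS.
Proof.
move=> U0 sU; have [u [u0 uU ual]] := nil_socle U0 sU.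
have uE := uniserial_soc ual; rewrite [u *m w]mx11_scalar mul_scalar_mx in uE.
have c0 : (u *m w) 0 0 != 0.
  by apply: contra u0 => /eqP c0; rewrite uE c0 scale0r.
by rewrite -(eqmx_scale _ c0) -uE.
Qed.

Lemma uniserial_dim : (0 < mdim M)%N.
Proof.
have := uniserial_soc_neq0; rewrite -mxrank_eq0 -lt0n => r0.
by apply: leq_trans r0 (rank_leq_col _).
Qed.

Lemma uniserial_indec : indecomposable_mod M.
Proof.
split; first exact: uniserial_dim.
move=> U V sU sV UV0 _; have [->|U0] := eqVneq U 0; first by left.
have [->|V0] := eqVneq V 0; [by right | exfalso].
have : (v *m act M (al ^+ l.-1) <= U :&: V)%MS.
  by rewrite sub_capmx !uniserial_uniform.
by rewrite UV0 submx0 (negPf uniserial_soc_neq0).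
Qed.

Lemma uniserial_embed N (f : 'M[K]_(mdim M, mdim N)) : is_hom f ->
  v *m act M (al ^+ l.-1) *m f != 0 -> row_free f.
Proof.
move=> hf sf; rewrite -kermx_eq0; apply: contraNT sf => k0.
apply/eqP/sub_kermxP; apply: uniserial_uniform => //; exact: submod_ker.
Qed.

Lemma uniserial_cohom N (w' : 'cV[K]_(mdim N)) :
  act N (e (iter l S z)) *m w' = w' -> act N (al ^+ l) *m w' = 0 ->
  is_hom (hom_sum w' v l).
Proof.
by have [vz _ vl _ _] := Mi; move=> w'y w'l; apply: hom_sum_hom w'y vz w'l vl.
Qed.

Lemma uniserial_hom N (u : 'rV[K]_(mdim N)) :
  u *m act N (e (S z)) = u -> u *m act N (al ^+ l) = 0 -> is_hom (hom_sum w u l).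
Proof.
have [_ wy _ _ _] := Mi; move=> uz ul; apply: hom_sum_hom wy uz _ ul.
by rewrite uniserial_nil mul0mx.
Qed.

Lemma plen_row N (u : 'rV[K]_(mdim N)) k : u *m act N (e (S z)) = u ->
  (plen (S z) <= k)%N -> u *m act N (al ^+ k) = 0.
Proof.
by move=> <-; rewrite -plenP => /eqP c0; rewrite -act_hom c0 rmorph0 mulmx0.
Qed.

(** A morphism from [M] is determined by the image of [v]. A preimage of [v *m f] at vertex [S z]
    defines the lift, since it satisfies the only relation imposed on [v]. *)
Lemma uniserial_proj : l = plen (S z) -> projective_mod M.
Proof.
move=> lE N N' g f hg cg hf; have [vz _ vl M1 _] := Mi.
pose u := v *m f *m pinvmx g *m act N (e (S z)).
have uz : u *m act N (e (S z)) = u by rewrite -act_hom vtxM eqxx.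
have ug : u *m g = v *m f.
  rewrite -mulmxA hg mulmxA mulmxKpV; last exact: submx_full.
  by rewrite -mulmxA -hf mulmxA vz.
clearbody u; exists (hom_sum w u l).
  by apply: uniserial_hom => //; apply: plen_row; rewrite ?lE.
rewrite -[RHS]mul1mx -M1 !mulmx_suml; apply: eq_bigr => k _.
rewrite -[LHS]mulmxA -[RHS]mulmxA; congr (_ *m _).
by rewrite -!mulmxA hg hf !mulmxA ug.
Qed.

Lemma ilen_col N (w' : 'cV[K]_(mdim N)) y k : act N (e y) *m w' = w' ->
  (ilen y <= k)%N -> act N (al ^+ k) *m w' = 0.
Proof.
by move=> <-; rewrite -ilenP => /eqP c0; rewrite mulmxA -actM c0 rmorph0 mul0mx.
Qed.

(** Dually, a morphism to [M] is determined by its composite with the socle coordinate [w]; it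
    suffices to extend the form [f *m w] along [g]. *)
Lemma uniserial_inj : l = ilen (iter l S z) -> injective_mod M.
Proof.
move=> lE N N' g f hg rg hf; have [vz wy vl M1 _] := Mi.
have [g' gg'] := row_freeP rg.
pose w' := act N' (e (iter l S z)) *m (g' *m (f *m w)).
have w'y : act N' (e (iter l S z)) *m w' = w' by rewrite mulmxA -actM vtxM eqxx.
have gw : g *m w' = f *m w.
  rewrite mulmxA -hg -mulmxA (mulmxA g) gg' mul1mx mulmxA hf -mulmxA.
  by rewrite wy.
clearbody w'; exists (hom_sum w' v l).
  by apply: uniserial_cohom => //; apply: ilen_col w'y _; rewrite -lE.
rewrite -[RHS]mulmx1 -M1 !mulmx_sumr; apply: eq_bigr => k _.
rewrite [LHS]mulmxA [RHS]mulmxA; congr (_ *m _).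
by rewrite !mulmxA -hg -hf -!mulmxA gw.
Qed.

End IntervalModule.
End Intervals.

(** * Indecomposable projectives and injectives *)

Section Classification.
Variables (K : fieldType) (A : falgType K) (n : nat).
Variable D : cyclic_presentation A n.
Implicit Types (M N P I J : fgmod A) (x y z : 'I_n).

Local Notation e := (vtx D).
Local Notation al := (arr D).
Local Notation S := (@ordS n).
Local Notation hom_sum := (@hom_sum _ _ _ D _ _).
Local Notation uniserial M := (@uniserial _ _ _ D M).
Local Notation plen := (plen D).
Local Notation ilen := (ilen D).

(* The injective hull of the simple module at y is the interval ]cosyz y, y];
   it is projective if and only if projinj y. *)
Definition cosyz y := iter (ilen y) (@ord_pred n) y.
Definition projinj y := (ilen (S y) <= ilen y)%N.

Lemma iterSK k : cancel (iter k (@ord_pred n)) (iter k S).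
Proof. by elim: k => [|k IH] x //; rewrite iterS [iter _.+1 _ x]iterSr IH ord_predK. Qed.

Lemma cosyzK y : iter (ilen y) S (cosyz y) = y.
Proof. exact: iterSK. Qed.

(** The longest nonzero path ending at [y] starts at [S (cosyz y)]. *)
Lemma ilen_le_plen y : (ilen y <= plen (S (cosyz y)))%N.
Proof.
rewrite -[X in (X <= _)%N](prednK (ilen_gt0 D y)) ltnNge -plenP vtxX.
rewrite -iterSr prednK ?ilen_gt0 // cosyzK.
by rewrite ilenP -ltnNge prednK ?ilen_gt0.
Qed.

(** Both sides say that the path of length [ilen y] from [S (cosyz y)] to [S y] is zero. *)
Lemma projinjP y : projinj y = (plen (S (cosyz y)) == ilen y).
Proof.
rewrite eqn_leq ilen_le_plen andbT -plenP vtxX -iterSr iterS cosyzK.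
by rewrite ilenP.
Qed.

Lemma plen_le_ilen z : (plen (S z) <= ilen (iter (plen (S z)) S z))%N.
Proof.
rewrite -[X in (X <= _)%N](prednK (plen_gt0 D (S z))) ltnNge -ilenP.
have := vtxX D (S z) (plen (S z)).-1.
rewrite -iterSr prednK ?plen_gt0 // => <-.
by rewrite plenP -ltnNge prednK ?plen_gt0.
Qed.

Lemma uniserial_transport M N z l v w : uniserial M z l v w -> iso_mod M N ->
  exists v' w', uniserial N z l v' w'.
Proof.
move=> [vz wy vl M1 vk] /iso_inv[f [g [hf hg fg gf]]].
exists (v *m f), (g *m w); split.
- by rewrite -mulmxA -hf mulmxA vz.
- by rewrite mulmxA hg -mulmxA wy.
- by rewrite -mulmxA -hf mulmxA vl mul0mx.
- transitivity (g *m 1%:M *m f); last by rewrite mulmx1.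
  rewrite -M1 mulmx_sumr mulmx_suml; apply: eq_bigr => k _.
  by rewrite !mulmxA hg -!mulmxA hf.
- by move=> k; rewrite -vk -!mulmxA (mulmxA _ g) hg -!(mulmxA g) (mulmxA f) fg mul1mx.
Qed.

Lemma uniserial_unique M N z l v w v' w' :
  uniserial M z l v w -> uniserial N z l v' w' -> iso_mod M N.
Proof.
move=> Mi Ni; have [vz _ vl _ _] := Mi; have [vz' _ vl' _ _] := Ni.
have hf := uniserial_hom Mi vz' vl'; have hg := uniserial_hom Ni vz vl.
have vf := uniserial_gen Mi v'; have vg := uniserial_gen Ni v.
apply: (iso_of_row_free hf).
  apply: (uniserial_embed Mi) => //.
  by rewrite -mulmxA hf mulmxA vf (uniserial_soc_neq0 Ni).
apply: (uniserial_embed Ni) => //.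
by rewrite -mulmxA hg mulmxA vg (uniserial_soc_neq0 Mi).
Qed.

Lemma proj_model z : exists P v w, uniserial P z (plen (S z)) v w.
Proof. by apply: uniserial_exists; rewrite ?plen_gt0. Qed.

Lemma inj_model y : exists I v w, uniserial I (cosyz y) (ilen y) v w.
Proof. by apply: uniserial_exists; rewrite ?ilen_gt0 ?ilen_le_plen. Qed.

Lemma simple_model y : exists M v w, uniserial M (ord_pred y) 1 v w.
Proof. by apply: uniserial_exists; rewrite ?plen_gt0. Qed.

Lemma dual_vec N (s : 'rV[K]_(mdim N)) y : s != 0 -> s *m act N (e y) = s ->
  exists2 w : 'cV_(mdim N), act N (e y) *m w = w & s *m w = 1%:M.
Proof.
move=> s0 sy; have /row_freeP[w sw] : row_free s by rewrite /row_free rank_rV s0.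
exists (act N (e y) *m w); first by rewrite mulmxA -actM vtxM eqxx.
by rewrite mulmxA sy.
Qed.

Lemma dual_covec N (w : 'cV[K]_(mdim N)) x : w != 0 -> act N (e x) *m w = w ->
  exists2 u : 'rV_(mdim N), u *m act N (e x) = u & u *m w = 1%:M.
Proof.
move=> w0 wx; have /row_fullP[u uw] : row_full w.
  by rewrite /row_full -mxrank_tr rank_rV trmx_eq0 w0.
exists (u *m act N (e x)); first by rewrite -act_hom vtxM eqxx.
by rewrite -mulmxA wx.
Qed.

Lemma to_inj_model J I y (s : 'rV[K]_(mdim J)) v w :
  uniserial I (cosyz y) (ilen y) v w -> s != 0 -> s *m act J (e y) = s ->
  s *m act J al = 0 ->
  exists2 f : 'M[K]_(mdim J, mdim I), is_hom f
    & s *m f = v *m act I (al ^+ (ilen y).-1).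
Proof.
move=> Ii s0 sy sal; have [w' w'y sw'] := dual_vec s0 sy.
have hf : is_hom (hom_sum w' v (ilen y)).
  by apply: (uniserial_cohom Ii); [rewrite cosyzK | exact: ilen_col w'y _].
exists (hom_sum w' v (ilen y)) => //.
have lt0 := ilen_gt0 D y; rewrite mulmx_sumr (bigD1 (Ordinal lt0)) //= big1.
  by rewrite addr0 expr0 act1 mul1mx mulmxA sw' mul1mx subn1.
move=> k nk; have k0 : (0 < k)%N by rewrite lt0n.
by rewrite -(prednK k0) exprS actM !mulmxA sal !mul0mx.
Qed.

(** The map [f] from [J] to the model is injective because its kernel misses [s]. It splits as [J]
    is injective, and the retraction [g] is injective because it does not kill the socle. *)
Lemma inj_hull J y (s : 'rV[K]_(mdim J)) : injective_mod J -> s != 0 ->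
  s *m act J (e y) = s -> s *m act J al = 0 ->
  (forall U : 'M[K]_(mdim J), submod U -> U != 0 -> (s <= U)%MS) ->
  exists v w, uniserial J (cosyz y) (ilen y) v w.
Proof.
move=> Jinj s0 sy sal ess; have [I [v [w Ii]]] := inj_model y.
have [f hf sf] := to_inj_model Ii s0 sy sal.
have rf : row_free f.
  rewrite -kermx_eq0; apply: contraT => k0.
  have /sub_kermxP := ess _ (submod_ker hf) k0.
  by rewrite sf => /eqP; rewrite (negPf (uniserial_soc_neq0 Ii)).
have [g hg fg] := Jinj _ _ _ _ hf rf (@is_hom1 _ _ J).
have rg : row_free g.
  by apply: (uniserial_embed Ii) => //; rewrite -sf -mulmxA fg mulmx1.
by apply: (uniserial_transport Ii); apply: iso_of_row_free hg rg rf.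
Qed.

(** Choose a socle vector [s] of [J]. One map [f] to the model sends [s] to its socle vector [t];
    injectivity of [J] gives [g] back with [t] sent to [s]. Then [f *m g] fixes [s], and Fitting's
    lemma applies. *)
Lemma indec_inj J : indecomposable_mod J -> injective_mod J ->
  exists y v w, uniserial J (cosyz y) (ilen y) v w.
Proof.
move=> Jind Jinj.
have J1 : (1%:M : 'M[K]_(mdim J)) != 0.
  by rewrite -mxrank_eq0 mxrank1 -lt0n; have [] := Jind.
have [y [s [s0 _ sal sy]]] := socle_vertex D J1 (submod_img (@is_hom1 _ _ J)).
exists y; have [I [v [w Ii]]] := inj_model y.
have [f hf sf] := to_inj_model Ii s0 sy sal.
have [E [v0 [w0 Ei]]] := simple_model y.
have ya : ordS (ord_pred y) = y by rewrite ord_predK.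
have sal1 : s *m act J (al ^+ 1) = 0 by rewrite expr1.
set t := v *m act I (al ^+ (ilen y).-1) in sf.
have ty : t *m act I (e y) = t by have := uniserial_soc_vtx Ii; rewrite cosyzK.
have tal : t *m act I (al ^+ 1) = 0 by rewrite expr1 (uniserial_soc_al Ii).
have hi : is_hom (hom_sum w0 t 1) by apply: (uniserial_hom Ei); rewrite ?ya.
have hj : is_hom (hom_sum w0 s 1) by apply: (uniserial_hom Ei); rewrite ?ya.
have ti := uniserial_gen Ei t; have sj := uniserial_gen Ei s.
have ri : row_free (hom_sum w0 t 1).
  apply: (uniserial_embed Ei) => //.
  by rewrite /= expr0 act1 mulmx1 ti (uniserial_soc_neq0 Ii).
have [g hg ig] := Jinj _ _ _ _ hi ri hj.
have tg : t *m g = s by rewrite -sj -ig mulmxA ti.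
have rf : row_free f.
  apply: (@row_freeMl _ _ _ _ f g).
  by apply: (fitting_row Jind (is_homM hf hg) s0); rewrite mulmxA sf.
have rg : row_free g by apply: (uniserial_embed Ii); rewrite // -/t tg.
by apply: (uniserial_transport Ii); apply: iso_of_row_free hg rg rf.
Qed.

(** Dual to [indec_inj], with forms on the tops: [f] pulls the form [u] of [M] back to the form [t]
    of [P], and lifting along the top of [P] gives [g] pulling [t] back to [u]. Fitting's lemma
    applies to both composites. *)
Lemma indec_proj M : indecomposable_mod M -> projective_mod M ->
  exists z v w, uniserial M z (plen (S z)) v w.
Proof.
move=> Mind Mproj; have [x [u [u0 alu xu]]] := top_vertex D (proj1 Mind).
exists (ord_pred x); rewrite ord_predK; have := proj_model (ord_pred x).
rewrite ord_predK => -[P [v [w Pi]]].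
have [v' v'x v'u] := dual_covec u0 xu.
have hf : is_hom (hom_sum w v' (plen x)).
  apply: (uniserial_hom Pi); rewrite ?ord_predK //.
  by apply: (@plen_row _ _ _ D (ord_pred x)); rewrite ord_predK.
have fu : hom_sum w v' (plen x) *m u = act P (al ^+ (plen x).-1) *m w.
  have ltx : ((plen x).-1 < plen x)%N by rewrite prednK ?plen_gt0.
  rewrite mulmx_suml (bigD1 (Ordinal ltx)) //= big1 ?addr0 => [|k nk].
    by rewrite prednK ?plen_gt0 // subnn expr0 act1 mulmx1 -!mulmxA v'u mulmx1.
  have k0 : (0 < plen x - k.+1)%N.
    rewrite subn_gt0 ltn_neqAle ltn_ord andbT; apply: contra nk => /eqP kx.
    by apply/eqP/val_inj; rewrite /= -[LHS]/(k.+1.-1) kx.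
  by rewrite -(prednK k0) exprSr actM -!mulmxA alu !mulmx0.
set f := hom_sum w v' (plen x) in hf fu.
have [E [v0 [w0 Ei]]] := simple_model x.
have [v0x _ v01 E1 /(_ 0%N) v0w0] := Ei.
rewrite expr0 act1 mulmx1 in v0w0; rewrite hom_sum1 in E1.
have [vx wy _ _ /(_ (plen x).-1) vt] := Pi; rewrite eqxx -mulmxA in vt.
set t := act P (al ^+ (plen x).-1) *m w in vt fu.
have tx : act P (e (iter 1 S (ord_pred x))) *m t = t.
  by apply: vtx_col; rewrite -iterD addn1 prednK ?plen_gt0.
have alt : act P (al ^+ 1) *m t = 0.
  rewrite mulmxA -actM -exprD add1n prednK ?plen_gt0 //.
  by rewrite (uniserial_nil Pi) mul0mx.
have hP := hom_sum_hom tx v0x alt v01.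
have hM : is_hom (hom_sum u v0 1).
  by apply: (hom_sum_hom _ v0x); rewrite ?expr1 //= ord_predK.
rewrite !hom_sum1 in hP hM; clearbody t.
have rP : row_full (t *m v0).
  by apply/row_fullP; exists (w0 *m v); rewrite -mulmxA (mulmxA v) vt mul1mx.
have [g hg gp] := Mproj _ _ _ _ hP rP hM.
have gt : g *m t = u by rewrite -[LHS]mulmx1 -[RHS]mulmx1 -v0w0 !mulmxA -gp mulmxA.
have t0 : t != 0.
  apply/eqP => t0; move: vt; rewrite t0 mulmx0 => /matrixP/(_ 0 0).
  by rewrite !mxE eqxx => /esym/eqP; rewrite oner_eq0.
have rg : row_free g.
  apply: (@row_freeMl _ _ _ _ g f).
  apply: (fitting_col Mind (is_homM hg hf) u0).
  by rewrite -mulmxA fu.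
have rf : row_free f.
  apply: (@row_freeMl _ _ _ _ f g).
  apply: (fitting_col (uniserial_indec Pi) (is_homM hf hg) t0).
  by rewrite -mulmxA gt fu.
by apply: (uniserial_transport Pi); apply: iso_of_row_free hf rf rg.
Qed.

(** Otherwise [J] is a proper quotient of a longer projective [P]. A section would send [v] into the
    radical of [P], as [v] is killed by too small a power of [al]; composing back to [J] then kills
    the socle. *)
Lemma inj_model_proj J y v w : uniserial J (cosyz y) (ilen y) v w ->
  projective_mod J -> projinj y.
Proof.
move=> Ji Jproj; rewrite projinjP eqn_leq ilen_le_plen andbT leqNgt.
apply/negP => lt; have [P [v' [w' Pi]]] := proj_model (cosyz y).
have [vz _ vl _ _] := Ji; have vl' := plen_row vz (leqnn _).
have hf := uniserial_hom Pi vz vl'; have vf := uniserial_gen Pi v.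
set f := hom_sum _ _ _ in hf vf.
have cf : row_full f.
  rewrite -sub1mx [X in (X <= _)%MS](uniserial_expand Ji); apply: summx_sub => k _.
  apply: submx_trans (submxMl _ _) _.
  by rewrite -vf -mulmxA -hf mulmxA submxMl.
have [g hg gf] := Jproj _ _ _ _ hf cf (@is_hom1 _ _ J).
have := uniserial_soc_neq0 Ji; rewrite -{1}[v]mulmx1 -gf mulmxA.
rewrite [v *m g](uniserial_expand Pi) !mulmx_suml big1 ?eqxx // => k _.
have [E|nk] := eqVneq (k : nat) (plen (S (cosyz y))).-1.
  have -> : v *m g *m act P (al ^+ k) = 0.
    rewrite -mulmxA -hg mulmxA (_ : v *m _ = 0) ?mul0mx //.
    have lk : (ilen y <= k)%N by rewrite E -ltnS prednK ?plen_gt0.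
    by rewrite -(subnKC lk) exprD act_hom vl mul0mx.
  by rewrite !mul0mx.
have k0 : (0 < plen (S (cosyz y)) - k.+1)%N.
  rewrite subn_gt0 ltn_neqAle ltn_ord andbT; apply: contra nk => /eqP kx.
  by rewrite -[X in X == _]/(k.+1.-1) kx.
rewrite -!mulmxA (mulmxA _ f) hf -mulmxA -actM -exprD (mulmxA v') vf.
rewrite -(prednK k0) addSnnS [(ilen y).-1.+1]prednK ?ilen_gt0 //.
rewrite (addnC _.-1 (ilen y)) exprD actM (mulmxA v (act J (al ^+ ilen y))) vl.
by rewrite mul0mx !mulmx0.
Qed.

End Classification.

(** * Minimal injective coresolutions *)

Section Coresolution.
Variables (K : fieldType) (A : falgType K) (n : nat).
Variable D : cyclic_presentation A n.
Implicit Types (M N P I J : fgmod A) (x y z : 'I_n).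

Local Notation e := (vtx D).
Local Notation al := (arr D).
Local Notation S := (@ordS n).
Local Notation hom_sum := (@hom_sum _ _ _ D _ _).
Local Notation uniserial M := (@uniserial _ _ _ D M).
Local Notation plen := (plen D).
Local Notation ilen := (ilen D).
Local Notation cosyz := (cosyz D).
Local Notation projinj := (projinj D).

Lemma submod_cap M m1 m2 (U : 'M[K]_(m1, mdim M)) (V : 'M[K]_(m2, mdim M)) :
  submod U -> submod V -> submod (U :&: V)%MS.
Proof.
move=> sU sV a; rewrite sub_capmx.
by rewrite (submx_trans (submxMr _ (capmxSl _ _)) (sU a))
  (submx_trans (submxMr _ (capmxSr _ _)) (sV a)).
Qed.

Lemma eqmx_ker_eq0 m1 m2 p (u : 'rV[K]_p) (f : 'M[K]_(p, m1)) (g : 'M[K]_(p, m2)) :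
  (kermx f :=: kermx g)%MS -> (u *m f == 0) = (u *m g == 0).
Proof. by move=> fg; rewrite -!sub_kermx fg. Qed.

(** * One step of a minimal coresolution *)

Section Step.
Variables (J J' : fgmod A) (z : 'I_n) (m l : nat).
Variables (v : 'rV[K]_(mdim J)) (w : 'cV[K]_(mdim J)).
Variable f : 'M[K]_(mdim J, mdim J').
Hypotheses (Ji : uniserial J z m v w) (hf : is_hom f) (J'inj : injective_mod J').
Hypotheses (fess : essential f) (lm : (l < m)%N).
Hypothesis kerf : (kermx f :=: kermx (act J (al ^+ l)))%MS.

Let k := (m - l)%N.
Let k_gt0 : (0 < k)%N. Proof. by rewrite subn_gt0. Qed.
(** The kernel of [f] is spanned by the [v al^i] with [k <= i], so [s] spans the socle of the
    image. *)
Let s := v *m act J (al ^+ k.-1) *m f.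

Let vf0 i : (k <= i)%N -> v *m act J (al ^+ i) *m f = 0.
Proof.
move=> ki; apply/eqP; rewrite (eqmx_ker_eq0 _ kerf) -act_hom -exprD.
have [_ _ vl _ _] := Ji; have mi : (m <= i + l)%N by rewrite addnC -leq_subLR.
by rewrite -(subnKC mi) exprD act_hom vl mul0mx.
Qed.

Let s_neq0 : s != 0.
Proof.
rewrite (eqmx_ker_eq0 _ kerf) -act_hom -exprD.
have -> : (k.-1 + l = m.-1)%N.
  by rewrite -[in RHS](subnK (ltnW lm)) -/k -{2}(prednK k_gt0) addSn.
exact: uniserial_soc_neq0 Ji.
Qed.

Let s_al : s *m act J' al = 0.
Proof. by rewrite /s -mulmxA -hf mulmxA -act_hom -exprSr prednK // vf0. Qed.

Let s_vtx : s *m act J' (e (iter k S z)) = s.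
Proof.
have [vz _ _ _ _] := Ji.
rewrite /s -mulmxA -hf mulmxA -[X in iter X S z](prednK k_gt0) iterSr.
by rewrite (vtx_row _ vz).
Qed.

Let s_ess (U : 'M[K]_(mdim J')) : submod U -> U != 0 -> (s <= U)%MS.
Proof.
move=> sU U0; have Uf0 : (U :&: f)%MS != 0.
  by apply: contra U0 => /eqP Uf; apply/eqP/fess.
have sUf := submod_cap sU (submod_img hf).
have [u [u0 uUf ual]] := nil_socle D Uf0 sUf.
move: uUf; rewrite sub_capmx => /andP[uU /submxP[r uE]].
have ral : r *m act J (al ^+ l.+1) = 0.
  rewrite exprS act_hom; apply/eqP; rewrite -(eqmx_ker_eq0 _ kerf).
  by rewrite -mulmxA hf mulmxA -uE ual.
suff us : u = r *m act J (al ^+ l) *m w *m s.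
  rewrite [_ *m w]mx11_scalar mul_scalar_mx in us.
  have c0 : (r *m act J (al ^+ l) *m w) 0 0 != 0.
    by apply: contra u0 => /eqP c0; rewrite us c0 scale0r.
  by rewrite -(eqmx_scale _ c0) -us.
(* Terms with [i < l] lie in the kernel of [f], those with [i > l] vanish as [r al^(l+1) = 0]. *)
rewrite uE [in LHS](uniserial_expand Ji r) mulmx_suml.
rewrite (bigD1 (Ordinal lm)) //= big1 ?addr0 => [|i].
  by rewrite -[LHS]mulmxA subnS.
rewrite -val_eqE /= neq_ltn => /orP[il|li].
  by rewrite -mulmxA vf0 ?mulmx0 // leq_sub2l.
by rewrite -(subnKC li) exprD act_hom ral !mul0mx.
Qed.

Lemma step_uniserial :
  exists v' w', uniserial J' (cosyz (iter k S z)) (ilen (iter k S z)) v' w'.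
Proof. exact: inj_hull J'inj s_neq0 s_vtx s_al s_ess. Qed.

(** With exactness, this is the hypothesis [kerf] of the next step. A vector killed by [al^(j+1)] is
    corrected by a multiple of a vector of the image until [al^j] kills it. *)
Lemma step_img : (f :=: kermx (act J' (al ^+ k)))%MS.
Proof.
have [v' [w' J'i]] := step_uniserial.
apply/eqmxP/andP; split.
  apply/sub_kermxP; rewrite -hf.
  apply/sub_kermxP; rewrite kerf; apply/sub_kermxP.
  by rewrite -actM -exprD subnK ?(ltnW lm) // (uniserial_nil Ji).
apply/rV_subP => u /sub_kermxP; move: u.
have sw : (s *m w') 0 0 != 0.
  apply: contra s_neq0 => /eqP c0; have := uniserial_soc J'i s_al.
  by rewrite [s *m w']mx11_scalar c0 mul_scalar_mx scale0r => ->.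
elim: {-2}k (leqnn k) => [_ u|j IH jk u uj].
  by rewrite expr0 act1 mulmx1 => ->; rewrite sub0mx.
pose x := v *m act J (al ^+ (k.-1 - j)) *m f.
have xj : x *m act J' (al ^+ j) = s.
  by rewrite -mulmxA -hf mulmxA -act_hom -exprD subnK // -ltnS prednK.
pose a := (u *m act J' (al ^+ j) *m w') 0 0 / (s *m w') 0 0.
have -> : u = (u - a *: x) + a *: x by rewrite subrK.
apply: addmx_sub; last by rewrite scalemx_sub // submxMl.
apply: IH; first exact: ltnW.
apply: (uniserial_soc_step J'i).
  rewrite mulmxBl uj -scalemxAl exprSr act_hom xj s_al.
  by rewrite scaler0 subr0.
rewrite !mulmxBl -!scalemxAl xj [s *m w']mx11_scalar scale_scalar_mx.
by rewrite divfK // -mx11_scalar subrr.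
Qed.

End Step.

Lemma ilen_iter x k : (ilen (iter k S x) <= ilen x + k)%N.
Proof.
elim: k => [|k IH]; first by rewrite addn0.
by rewrite iterS addnS (leq_trans (ilenS D _)).
Qed.

(* The cosyzygy of the interval ]z, y] is ]cosyz y, z], whose injective hull is
   ]cosyz z, z]. *)
Lemma coresolution_state M z v w (C : min_inj_coresolution M) :
  uniserial M z (plen (S z)) v w -> ~ injective_mod M ->
  forall i, (forall j, (j <= i)%N -> projective_mod (inj_term C j)) ->
  exists z' y' l v' w',
   [/\ uniserial (inj_term C i) (cosyz y') (ilen y') v' w',
       (kermx (codiff C i) :=: kermx (act (inj_term C i) (al ^+ l)))%MS,
       iter l S z' = y' /\ (0 < l < ilen y')%N,
       (z', y') = iter i (fun p => (cosyz p.2, p.1)) (z, iter (plen (S z)) S z)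
     & projinj y'].
Proof.
move=> Mi Minj; elim=> [|i IH] pr.
  have k0 : (kermx (coaug C) :=: kermx (act M (al ^+ 0)))%MS.
    have /eqP-> : kermx (coaug C) == 0 by rewrite kermx_eq0 coaug_inj.
    have /eqP-> : kermx (act M (al ^+ 0)) == 0.
      by rewrite expr0 act1 kermx_eq0 /row_free mxrank1.
    by [].
  have st := step_uniserial Mi (coaug_hom C) (@inj_termP _ _ _ C 0)
    (@coaug_min _ _ _ C) (plen_gt0 D _) k0.
  have im := step_img Mi (coaug_hom C) (@inj_termP _ _ _ C 0)
    (@coaug_min _ _ _ C) (plen_gt0 D _) k0.
  rewrite subn0 in st im; have [v' [w' Ii]] := st.
  exists z, (iter (plen (S z)) S z), (plen (S z)), v', w'; split=> //.
  - by apply: eqmx_trans im; apply/eqmx_sym/(coaug_exact C).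
  (* If the two lengths agreed, [M] would be its own injective hull. *)
  - split=> //; rewrite plen_gt0 /= ltn_neqAle plen_le_ilen andbT.
    by apply/eqP => E; apply: Minj; apply: uniserial_inj Mi _.
  - by apply: inj_model_proj Ii _; apply: pr.
have [z' [y' [l [v' [w' [Ii kerI [zy /andP[l0 ly]] zyE gy]]]]]] :
  exists z' y' l v' w', _ := IH (fun j ji => pr j (leqW ji)).
have st := step_uniserial Ii (codiff_hom C i) (@inj_termP _ _ _ C i.+1)
  (@codiff_min _ _ _ C i) ly kerI.
have im := step_img Ii (codiff_hom C i) (@inj_termP _ _ _ C i.+1)
  (@codiff_min _ _ _ C i) ly kerI.
have zE : iter (ilen y' - l) S (cosyz y') = z'.
  by apply: (@iterS_inj _ l); rewrite -iterD subnKC ?cosyzK // ltnW.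
rewrite zE in st; have [v1 [w1 I1]] := st.
have gz : projinj z' by apply: inj_model_proj I1 _; apply: pr.
exists (cosyz y'), z', (ilen y' - l)%N, v1, w1; split=> //.
- by apply: eqmx_trans im; apply/eqmx_sym/(codiff_exact C).
(* Since [y' = S^(l-1) (S z')] and [z'] is good, [ilen y' <= ilen z' + l - 1]. *)
- split=> //; rewrite subn_gt0 ly -(ltn_add2l l) subnKC ?(ltnW ly) //.
  rewrite -zy -(prednK l0) iterSr addSn ltnS addnC.
  by rewrite (leq_trans (ilen_iter _ _)) // leq_add2r.
- by rewrite iterS -zyE.
Qed.

Lemma iter_swap2 (T : Type) (g : T -> T) (z y : T) k :
  iter k.*2 (fun p => (g p.2, p.1)) (z, y) = (iter k g z, iter k g y).
Proof. by elim: k => //= k ->. Qed.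

(** The term of index [2k + 1] is the injective hull of the simple module at [cosyz^k z]. *)
Lemma coresolution_bound M z v w (C : min_inj_coresolution M) k :
  uniserial M z (plen (S z)) v w -> ~ injective_mod M ->
  (forall j, (j <= k.*2.+1)%N -> projective_mod (inj_term C j)) ->
  projinj (iter k cosyz z).
Proof.
move=> Mi Minj pr.
have [z' [y' [l [v' [w' [_ _ _]]]]]] := coresolution_state Mi Minj pr.
by rewrite iterS iter_swap2 => -[_ ->].
Qed.

End Coresolution.

(** * Counting orbits *)

Section OrbitCount.
Variables (T : finType) (g : T -> T) (G : {set T}).
Hypothesis g_inj : {in G &, injective g}.

Let Z := ~: [set g x | x in G].

(* Going backwards from a common point with injectivity on G, one of the two
   orbits arrives at its start, which is not a value of g on G. *)
Lemma exit_unique i j z z' : z \in Z -> z' \in Z ->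
  (forall k, (k < i)%N -> iter k g z \in G) ->
  (forall k, (k < j)%N -> iter k g z' \in G) ->
  iter i g z = iter j g z' -> i = j /\ z = z'.
Proof.
have notZ y m z1 : y \in Z -> (forall k, (k < m.+1)%N -> iter k g z1 \in G) ->
    y <> iter m.+1 g z1.
  rewrite inE => /negP yZ mG yE; apply: yZ; rewrite yE iterS.
  exact/imset_f/mG.
move=> zZ z'Z; elim: i j => [|i IH] [|j] iG jG //.
- by move/(notZ _ _ _ zZ jG).
- by move/esym/(notZ _ _ _ z'Z iG).
move=> E; have [->//] := IH j (fun k ki => iG k (ltnW ki))
  (fun k kj => jG k (ltnW kj))
  (g_inj (iG _ (leqnn _)) (jG _ (leqnn _)) E).
Qed.

(** An orbit staying in [G] forever would have pairwise distinct points by [exit_unique]. The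
    condition on [z] stands under the existential so that choice yields a total function. *)
Lemma exit_exists z : exists p, z \in Z ->
  iter p g z \notin G /\ forall k, (k < p)%N -> iter k g z \in G.
Proof.
have [zZ|] := boolP (z \in Z); last by exists 0%N.
have ex : exists k, iter k g z \notin G.
  apply: contrapT => /forallNP allG.
  have zG k : iter k g z \in G by apply: contrapT => /negP /allG.
  have inj : injective (fun k : 'I_#|T|.+1 => iter k g z).
    move=> i j ij; apply: val_inj.
    by have [] := exit_unique zZ zZ (fun k _ => zG k) (fun k _ => zG k) ij.
  by have := leq_card _ inj; rewrite card_ord ltnn.
exists (ex_minn ex) => _; case: ex_minnP => p pG pmin; split=> // k kp.
by apply: contraLR kp => /pmin; rewrite -leqNgt.
Qed.

(** The pairs [(z, k)] with [k < p z] inject into [G] through [iter k g z], and [Z] has as many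
    elements as the complement of [G]. *)
Lemma orbit_count : exists2 p : T -> nat,
  (forall z, z \in Z -> iter (p z) g z \notin G) &
  (\sum_(z in Z) (p z).*2.+1 + #|~: G| <= 2 * #|T|)%N.
Proof.
have [p pP] := choice exit_exists.
exists p => [z /pP[]//|].
have cardZ : #|Z| = #|~: G|.
  by rewrite /Z cardsCs finset.setCK (card_in_imset g_inj) [RHS]cardsCs finset.setCK.
have sum_p : (\sum_(z in Z) p z <= #|G|)%N.
  (* A common bound makes these pairs a subset of a finite type. *)
  pose N := (\max_z p z).+1.
  have pN z : (p z < N)%N by rewrite ltnS leq_bigmax.
  pose P (u : T * 'I_N) := (u.1 \in Z) && (u.2 < p u.1)%N.
  have -> : (\sum_(z in Z) p z = #|P|)%N.
    rewrite -sum1_card -(pair_big_dep (fun z => z \in Z)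
      (fun z (k : 'I_N) => k < p z)%N (fun _ _ => 1%N)) /=.
    apply: eq_bigr => z _.
    by rewrite -(big_ord_widen _ (fun=> 1%N)) ?sum1_card ?card_ord // ltnW.
  pose h (u : T * 'I_N) := iter u.2 g u.1.
  have hG u : u \in P -> h u \in G by move=> /andP[/pP[_]]; apply.
  have h_inj : {in P &, injective h}.
    move=> [z i] [z' j] /andP[/= zZ ip] /andP[/= z'Z jp] hij.
    have [||ij ->] := exit_unique zZ z'Z _ _ hij.
    - by move=> k ki; apply: (proj2 (pP _ zZ)); apply: ltn_trans ki ip.
    - by move=> k kj; apply: (proj2 (pP _ z'Z)); apply: ltn_trans kj jp.
    by congr (_, _); apply: val_inj.
  rewrite -(card_in_imset h_inj); apply/subset_leq_card/fintype.subsetP => x.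
  by move=> /imsetP[u uP ->]; apply: hG.
rewrite (eq_bigr (fun z => (p z).*2 + 1)%N) => [|z _]; last by rewrite addn1.
rewrite big_split /= sum1_card cardZ -(eq_bigr _ (fun z _ => mul2n (p z))).
rewrite -big_distrr /= -addnA addnn -mul2n -mulnDr leq_mul2l /=.
by rewrite -(cardsC G) leq_add2r.
Qed.

End OrbitCount.

(** * The bound for a presented algebra *)

Lemma esum_le_finsum (R : realType) (T : choiceType) (U : finType) (X : set T)
    (phi : T -> U) (a : T -> \bar R) (Z : {set U}) (F : U -> nat) :
  set_inj X phi -> (forall c, X c -> phi c \in Z) ->
  (forall c, X c -> (a c <= (F (phi c))%:R%:E)%E) ->
  (\esum_(c in X) a c <= ((\sum_(z in Z) F z)%:R)%:E)%E.
Proof.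
move=> inj XZ aF; pose b z : \bar R := (F z)%:R%:E.
apply: (le_trans (le_esum (b := b \o phi) aF)).
rewrite -(@esum_image _ _ _ X phi b inj) esum_mkcond.
apply: (@le_trans _ _ (\esum_(z in [set: U]%classic) (if z \in Z then b z else 0))%E).
  apply: le_esum => z _; case: ifPn => [|_].
    by rewrite inE => -[c Xc <-]; rewrite XZ.
  by case: ifP => _ //; rewrite lee_fin.
rewrite esum_fset; last 2 first.
- exact: finite_finset.
- by move=> z _; case: ifP => _ //; rewrite lee_fin.
rewrite fsbig_finite /=; last exact: finite_finset.
rewrite natr_sum -sumEFin [leRHS]big_mkcond /= (perm_big (index_enum U)) //.
apply: uniq_perm; rewrite ?finmap.fset_uniq ?index_enum_uniq // => z.
rewrite mem_index_enum in_fset_set; last exact: finite_finset.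
exact: mem_set.
Qed.

Lemma counting_le_card (R : realType) (T : choiceType) (U : finType) (X : set T)
    (phi : T -> U) (Z : {set U}) :
  set_inj X phi -> (forall c, X c -> phi c \in Z) ->
  (counting X <= (#|Z|%:R)%:E :> \bar R)%E.
Proof.
move=> inj XZ.
have finX : finite_set X.
  by rewrite -(eq_finite_set (inj_card_eq inj)); exact: finite_finset.
rewrite /counting asboolT //.
have := @esum_le_finsum R T U X phi (fun=> 1%E) Z (fun=> 1%N) inj XZ (fun _ _ => lexx _).
rewrite sum1_card; apply: le_trans.
rewrite esum_fset // fsbig_finite //= -sum1_size natr_sum -sumEFin.
exact: lexx.
Qed.

(** The terms are indexed from 0, so a last projective index [k] gives dominant dimension
    [k + 1]. *)
Lemma domdim_le (R : realType) (K : fieldType) (A : falgType K) (M : fgmod A) m :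
  (forall (C : min_inj_coresolution M) k,
     (forall i, (i <= k)%N -> projective_mod (inj_term C i)) -> (k <= m)%N) ->
  (domdim R M <= m.+1%:R%:E)%E.
Proof.
move=> Cm; rewrite /domdim; case: ifP => _; last by rewrite lee_fin.
rewrite -addn1 natrD EFinD leeD2r //; apply: ge_ereal_sup => _ [k [C Ck] <-].
by rewrite lee_fin ler_nat (Cm C).
Qed.

Section Bound.
Variables (K : fieldType) (A : falgType K) (n : nat).
Variable D : cyclic_presentation A n.

Local Notation S := (@ordS n).
Local Notation uniserial M := (@uniserial _ _ _ D M).
Local Notation plen := (plen D).
Local Notation ilen := (ilen D).
Local Notation cosyz := (cosyz D).
Local Notation projinj := (projinj D).

(** If [y' = S^d y] with [d = ilen y' - ilen y > 0], goodness of [y] gives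
    [ilen y' <= ilen y + d - 1], a contradiction. *)
Lemma cosyz_inj y y' : projinj y -> projinj y' -> cosyz y = cosyz y' -> y = y'.
Proof.
wlog le : y y' / (ilen y <= ilen y')%N => [hw gy gy' E|gy gy' E].
  have [le|/ltnW le] := leqP (ilen y) (ilen y'); first exact: hw.
  by apply/esym/hw.
have y'E : y' = iter (ilen y' - ilen y) S y.
  by rewrite -{1}(cosyzK D y') -{1}(subnK le) iterD -E cosyzK.
case: (posnP (ilen y' - ilen y)) y'E => [-> //|pos y'E].
have := ilen_iter D (S y) (ilen y' - ilen y).-1.
rewrite -iterSr prednK // -y'E => h; have := leq_trans h (leq_add gy (leqnn _)).
by rewrite -ltnS -addnS prednK // subnKC // ltnn.
Qed.

Lemma isoclass_inj (c c' : isoclass A) : iso_mod (repr c) (repr c') -> c = c'.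
Proof.
move=> cc'; rewrite -[c]reprK -[c']reprK; apply/eqquotP.
exact/asboolP.
Qed.

Let G := [set y | projinj y].
Let Z := ~: [set cosyz y | y in G].

Let G_inj : {in G &, injective cosyz}.
Proof. by move=> y y'; rewrite !inE; apply: cosyz_inj. Qed.

Lemma noninj_notin M z v w : uniserial M z (plen (S z)) v w ->
  ~ injective_mod M -> z \in Z.
Proof.
move=> Mi Minj; rewrite inE; apply/negP => /imsetP[y]; rewrite inE.
rewrite projinjP => /eqP yE zE; apply: Minj; apply: (uniserial_inj Mi).
by rewrite zE yE cosyzK.
Qed.

Lemma sdomdim_defect_le (R : realType) :
  (sdomdim A R <= (2 * n)%:R%:E - defect A R)%E.
Proof.
have [p pG count] := orbit_count G_inj; rewrite card_ord in count.
pose is_top (c : isoclass A) z := exists v w, uniserial (repr c) z (plen (S z)) v w.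
pose is_soc (c : isoclass A) y := exists v w, uniserial (repr c) (cosyz y) (ilen y) v w.
(* A default vertex for classes outside the two families; [n] is positive because 1 is nonzero in
   [A]. *)
have x0 : 'I_n.
  have [i _|I0] := pickP 'I_n; first exact: i.
  by have := oner_neq0 A; rewrite -(vtx_sum D) big_pred0 // eqxx.
have /choice[phi phiP] (c : isoclass A) : exists z,
    indecomposable_mod (repr c) -> projective_mod (repr c) -> is_top c z.
  have [ci|ni] := pselect (indecomposable_mod (repr c) /\ projective_mod (repr c)).
    by have [z [v [w ?]]] := indec_proj D ci.1 ci.2; exists z => _ _; exists v, w.
  by exists x0 => ci cp; case: ni.
have /choice[psi psiP] (c : isoclass A) : exists y,
    indecomposable_mod (repr c) -> injective_mod (repr c) -> is_soc c y.
  have [ci|ni] := pselect (indecomposable_mod (repr c) /\ injective_mod (repr c)).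
    by have [z [v [w ?]]] := indec_inj D ci.1 ci.2; exists z => _ _; exists v, w.
  by exists x0 => ci cp; case: ni.
have le1 : (sdomdim A R <= ((\sum_(z in Z) (p z).*2.+1)%:R)%:E)%E.
  apply: (esum_le_finsum (phi := phi)).
  - move=> c c'; rewrite !inE => -[ci cp _] [ci' cp' _] cc'.
    have [v [w ui]] := phiP _ ci cp; have [v' [w' ui']] := phiP _ ci' cp'.
    by apply: isoclass_inj; rewrite -cc' in ui'; apply: uniserial_unique ui ui'.
  - move=> c [ci cp cinj]; have [v [w ui]] := phiP _ ci cp.
    exact: noninj_notin ui cinj.
  move=> c [ci cp cinj]; have [v [w ui]] := phiP _ ci cp.
  have /pG := noninj_notin ui cinj; rewrite inE => /negP nG.
  (* If the terms up to index [2 * p z + 1] were projective, the exit point [cosyz^(p z) z] would be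
     good. *)
  apply: domdim_le => C k pr; rewrite leqNgt; apply/negP => lt; apply: nG.
  apply: (coresolution_bound (C := C) ui cinj) => j jk; apply: pr.
  exact: leq_trans jk lt.
have le2 : (defect A R <= (#|~: G|%:R)%:E)%E.
  apply: (@counting_le_card _ _ _ _ psi).
  - move=> c c'; rewrite !inE => -[ci cp _] [ci' cp' _] cc'.
    have [v [w ui]] := psiP _ ci cp; have [v' [w' ui']] := psiP _ ci' cp'.
    by apply: isoclass_inj; rewrite -cc' in ui'; apply: uniserial_unique ui ui'.
  - move=> c [ci cinj cp]; have [v [w ui]] := psiP _ ci cinj.
    rewrite !inE; apply/negP; rewrite projinjP => /eqP E.
    by apply: cp; apply: (uniserial_proj ui); rewrite E.
apply: (le_trans le1); apply: le_trans (leeB (lexx _) le2).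
by rewrite -EFinB lee_fin lerBrDr -natrD ler_nat.
Qed.

End Bound.

(** * Path algebras of the line and of the cycle *)

Section CyclicQuiver.
Variables (K : fieldType) (n : nat) (E : finType) (s t : E -> 'I_n).
Hypotheses (s_inj : injective s) (tE : forall a, t a = ordS (s a)).

Let Q := @Quiver 'I_n E s t.
Let PA := path_alg K Q.
Let path p : PA := path_elt K p.
Let triv (x : 'I_n) : qpath Q := ptriv (Q := Q) x.

Lemma arrow_walk a : walk (Q := Q) (s a) [:: a].
Proof. by rewrite /= eqxx. Qed.

Definition arrow_path a : qpath Q :=
  exist (fun p : vertex Q * seq (arrow Q) => walk p.1 p.2) (s a, [:: a]) (arrow_walk a).

Definition arrow_sum : PA := \sum_a path (arrow_path a).

Lemma pathM (p q : qpath Q) : path p * path q = path_mul K p q.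
Proof. exact: palg_mulUU. Qed.

Lemma trivM x y :
  path (triv x) * path (triv y) = if x == y then path (triv x) else 0.
Proof. by rewrite pathM /path_mul pcat1p; case: eqP => [->|]. Qed.

Lemma triv_arrow x : path (triv x) * arrow_sum = arrow_sum * path (triv (ordS x)).
Proof.
rewrite mulr_sumr mulr_suml; apply: eq_bigr => a _.
rewrite !pathM /path_mul pcat1p pcatp1.
rewrite -[pstart _]/(s a) -[pend _]/(t a) tE.
by rewrite (can_eq (@ordSK n)).
Qed.

(** Injectivity of [s] leaves at most one arrow that continues a path. *)
Lemma path_arrow p : path p * arrow_sum = 0 \/
  exists2 r, path p * arrow_sum = path r & plength r = (plength p).+1.
Proof.
rewrite mulr_sumr.
have [a /eqP sa|na] := pickP (fun a => s a == pend p); last first.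
  by left; apply: big1 => a _; rewrite pathM /path_mul /pcat eq_sym na.
have [r rE rv] := @pcat_val Q p (arrow_path a) (esym sa).
right; exists r; last by rewrite /plength /parrows rv size_cat addn1.
rewrite (bigD1 a) //= big1 ?addr0 => [|b ba]; first by rewrite pathM /path_mul rE.
rewrite pathM /path_mul /pcat eq_sym; case: eqP => // sb.
by case/eqP: ba; apply: s_inj; rewrite sa -sb.
Qed.

Lemma triv_arrowX x k : path (triv x) * arrow_sum ^+ k = 0 \/
  exists2 r, path (triv x) * arrow_sum ^+ k = path r & plength r = k.
Proof.
elim: k => [|k [IH|[r IH rk]]].
- by right; exists (triv x); rewrite // expr0 mulr1.
- by left; rewrite exprSr mulrA IH mul0r.
rewrite exprSr mulrA IH; case: (path_arrow r) => [->|[q -> ql]]; first by left.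
by right; exists q; rewrite // ql rk.
Qed.

(** A path is determined by its start and length, so the [e x al^k] span the algebra. *)
Lemma pathE p : path p = path (triv (pstart p)) * arrow_sum ^+ plength p.
Proof.
case: p => -[x us] /= wp; rewrite /pstart /plength /parrows /=.
elim/last_ind: us wp => [|us a IH] wp.
  rewrite expr0 mulr1; congr path; exact: val_inj.
have /andP[wus] : walk (Q := Q) x us && walk (Q := Q) (last x (map t us)) [:: a].
  by rewrite -(@walk_cat Q) cats1.
rewrite /= andbT => /eqP sa; rewrite size_rcons exprSr mulrA -(IH wus).
set p := exist _ _ _; set r := exist _ _ _.
have [r' rE rv] := @pcat_val Q r (arrow_path a) (esym sa).
have -> : p = r' by apply: val_inj; rewrite rv /= cats1.
rewrite mulr_sumr (bigD1 a) //= big1 ?addr0 => [|b ba].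
  by rewrite pathM /path_mul rE.
rewrite pathM /path_mul /pcat; case: eqP => // sb.
by case/eqP: ba; apply: s_inj; rewrite [RHS]sa; exact: esym.
Qed.

Lemma quiver_presentation (A : falgType K) :
  quiver_algebra Q A -> inhabited (cyclic_presentation A n).
Proof.
case=> phi [[phi1 phiM] phi_surj [adm2 [m m2 admm]]].
have phiX f k : phi (f ^+ k) = phi f ^+ k.
  by elim: k => [|k IH]; rewrite ?expr0 // !exprS phiM IH.
have pathI p k : (k <= plength p)%N -> in_arrow_ideal_pow k (path p).
  move=> kp q; rewrite -mcoeff_neq0 path_coef_elt.
  by have [<-|_] := eqVneq p q; rewrite ?eqxx.
constructor; exists (fun x => phi (path (triv x))) (phi arrow_sum).
- by move=> x y; rewrite -phiM trivM; case: ifP => // _; rewrite linear0.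
- by rewrite -linear_sum -phi1; congr (phi _).
(* The kernel lies in the square of the arrow ideal, and a trivial path has length 0. *)
- move=> x; apply/eqP => /adm2/(_ (triv x)).
  by rewrite -mcoeff_neq0 path_coef_elt eqxx oner_neq0 => /(_ isT).
- by move=> x; rewrite -!phiM triv_arrow.
- exists m; rewrite -phiX -[arrow_sum ^+ m]mul1r.
  rewrite -[1]/(palg_one K Q) /palg_one mulr_suml linear_sum big1 // => x _.
  case: (triv_arrowX x m) => [->|[r -> rm]]; first by rewrite linear0.
  by apply: admm; apply: pathI; rewrite rm.
move=> P P0 PD PZ Pp a; have [f <-] := phi_surj a.
elim/path_alg_ind: f => [|f g Pf Pg|k f Pf|p].
- by rewrite linear0.
- by rewrite linearD; apply: PD.
- by rewrite linearZ; apply: PZ.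
by rewrite -/(path p) pathE phiM phiX; apply: Pp.
Qed.

End CyclicQuiver.

Lemma nakayama_presentation (K : fieldType) (A : falgType K) n :
  nakayama A n -> inhabited (cyclic_presentation A n).
Proof.
case=> _ [|]; last by apply: quiver_presentation.
apply: quiver_presentation => [a b sab|a].
  apply: val_inj; case: a b sab => -[a a'] /= /eqP aa' [[b b'] /= /eqP bb'] ab.
  by congr (_, _) => //; apply: val_inj; rewrite /= -aa' -bb' ab.
(* On the line the successor of a source is below [n], so [ordS] does not wrap around. *)
by case: a => -[a a'] /= /eqP aa'; apply: val_inj; rewrite /= aa' modn_small.
Qed.

Theorem theorem2p1 (R : realType) (K : fieldType) (A : falgType K) (n : nat)
    (nakA : nakayama A n) (nsiA : ~ selfinjective A) :
  (sdomdim A R <= ((2 * n)%N%:R)%:E - defect A R)%E.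
Proof. by have [D] := nakayama_presentation nakA; apply: sdomdim_defect_le. Qed.
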